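(* Let $(M,H)$ be an $n$-dimensional Carnot manifold with weight sequence $(w_1,\ldots,w_n)$, let $(X_1,\ldots,X_n)$ be an $H$-frame near a point $a\in M$, and let $(x_1,\ldots,x_n)$ be privileged coordinates at $a$ adapted to $(X_1,\ldots,X_n)$. Then a change of coordinates $x\mapsto\phi(x)$ produces privileged coordinates at $a$ adapted to $(X_1,\ldots,X_n)$ if and only if $$\phi(x)=\hat\phi(x)+\operatorname{O}_w\left(\|x\|^{w+1}\right)\qquad\text{near }x=0,$$ where $\hat\phi(x)$ is a $w$-homogeneous polynomial diffeomorphism such that $\hat\phi'(0)=\operatorname{id}$.
   Context: A Carnot manifold of step $r$ is a pair $(M,H)$, where $M$ is a smooth manifold and $H=(H_1,\ldots,H_r)$ is a filtration of subbundles $H_1\subset\cdots\subset H_r=TM$ such that Lie brackets of sections of $H_w$ and $H_{w'}$ are sections of $H_{w+w'}$ whenever $w+w'\le r$. With $n=\dim M$, its weight sequence is $w_j=\min\{w\in\{1,\ldots,r\}:\ j\le\operatorname{rk}H_w\}$, $j=1,\ldots,n$. An $H$-frame over an open set is a tangent frame $(X_1,\ldots,X_n)$ such that each $X_j$ is a section of $H_{w_j}$. For a finite sequence $I=(i_1,\ldots,i_k)$ in $\{1,\ldots,n\}$ set $X_I=X_{i_1}\cdots X_{i_k}$ and $\langle I\rangle=w_{i_1}+\cdots+w_{i_k}$. A smooth function $f$ near $a$ has order $\ge N$ at $a$ ($N$ a non-negative integer) if $X_If(a)=0$ whenever $\langle I\rangle<N$; it has order $N$ if moreover $X_If(a)\neq0$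 for some $I$ with $\langle I\rangle=N$. Local coordinates centered at $a$ are linearly adapted at $a$ to $(X_1,\ldots,X_n)$ if, in these coordinates, $X_j(0)=\partial_j$ for $j=1,\ldots,n$. They are privileged coordinates at $a$ adapted to $(X_1,\ldots,X_n)$ if they are linearly adapted and, for every $k$, the coordinate function $x_k$ has order $w_k$ at $a$. Set $\delta_t(x)=t\cdot x=(t^{w_1}x_1,\ldots,t^{w_n}x_n)$ for $t\in\mathbb{R}$, $x\in\mathbb{R}^n$. A map $\phi:\mathbb{R}^n\to\mathbb{R}^n$ is $w$-homogeneous if $\phi(t\cdot x)=t\cdot\phi(x)$ for all $t\in\mathbb{R}$, $x\in\mathbb{R}^n$. A pseudo-norm is a continuous function $\|\cdot\|:\mathbb{R}^n\to[0,\infty)$, positive on $\mathbb{R}^n\setminus0$, with $\|t\cdot x\|=|t|\,\|x\|$, e.g. $\|x\|=\sum_j|x_j|^{1/w_j}$ (all pseudo-norms are equivalent); one is fixed. A smooth $\mathbb{R}^n$-valued map $\Theta=(\Theta_1,\ldots,\Theta_n)$ near $0$ is $\operatorname{O}_w(\|x\|^{w+m})$ if $\Theta_k(x)=\operatorname{O}(\|x\|^{w_k+m})$ near $x=0$ for every $k$.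
   Formalization: The condition φ'(0)=id is added to the right-hand side of the equivalence: without it the ''if'' direction fails, e.g. φ(x)=(x₁+x₂,x₂) on R² with weights (1,2), frame (∂₁,∂₂) and φ̂=id. *)

(* Defs.v *)
From HB Require Import structures.
From mathcomp Require Import all_boot all_order all_algebra.
From mathcomp Require Import all_classical all_reals all_analysis.
From mathcomp Require mpoly.

Set Implicit Arguments.
Unset Strict Implicit.
Unset Printing Implicit Defensive.

Import Order.TTheory GRing.Theory Num.Theory.
Import numFieldNormedType.Exports.

Local Open Scope classical_set_scope.
Local Open Scope ring_scope.

Section Euclidean.
Variables (R : realType) (n : nat).
Implicit Types (f : 'rV[R]_n -> R) (U : set 'rV[R]_n).

Definition partial (i : 'I_n) f : 'rV[R]_n -> R :=
  fun x => 'D_(delta_mx 0 i) f x.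

Definition partials (s : seq 'I_n) f : 'rV[R]_n -> R := foldr partial f s.

(* C^oo on U, for U open: iterated partial derivatives of all orders exist and
   are continuous at every point of U. *)
Definition smooth_on U f : Prop :=
  forall (s : seq 'I_n) x, U x ->
    {for x, continuous (partials s f)} /\
    forall i, derivable (partials s f) x (delta_mx 0 i).

Definition smooth_map_on U (F : 'rV[R]_n -> 'rV[R]_n) : Prop :=
  forall k, smooth_on U (fun x => F x 0 k).

(* F is a diffeomorphism of the open set U onto the open set F(U); G is only
   meaningful on F(U), where it is the inverse map. *)
Definition diffeo_on U (F G : 'rV[R]_n -> 'rV[R]_n) : Prop :=
  [/\ open U, open (F @` U), smooth_map_on U F, smooth_map_on (F @` U) G &
      {in U, cancel F G}].

Definition diffeomorphism (F : 'rV[R]_n -> 'rV[R]_n) : Prop :=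
  smooth_map_on setT F /\
  exists G, [/\ smooth_map_on setT G, cancel F G & cancel G F].

Definition polynomial_map (F : 'rV[R]_n -> 'rV[R]_n) : Prop :=
  forall k, exists p : mpoly.mpoly n R,
    forall x, F x 0 k = mpoly.meval (fun i => x 0 i) p.

Section Weights.
Variable w : 'I_n -> nat.

Definition dilation (t : R) (x : 'rV[R]_n) : 'rV[R]_n :=
  \row_j (t ^+ w j * x 0 j).

Definition w_homogeneous (F : 'rV[R]_n -> 'rV[R]_n) : Prop :=
  forall t x, F (dilation t x) = dilation t (F x).

Definition pseudo_norm (N : 'rV[R]_n -> R) : Prop :=
  [/\ continuous N, forall x, 0 <= N x, forall x, x != 0 -> 0 < N x &
      forall t x, N (dilation t x) = `|t| * N x].

(* Theta(x) = O_w(||x||^{w+m}) near x = 0, for the pseudo-norm N.  This does not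
   force Theta'(0) = 0, even for m > 0: the component Theta_k may contain linear
   terms x_j with w_j >= w_k + m.  So phi = phihat + O_w(||x||^{w+1}) and
   phihat'(0) = id do not imply phi'(0) = id. *)
Definition bigO_w (N : 'rV[R]_n -> R) (m : nat)
    (Theta : 'rV[R]_n -> 'rV[R]_n) : Prop :=
  forall k, (fun x => Theta x 0 k) =O_ (nbhs (0 : 'rV[R]_n))
            (fun x => N x ^+ (w k + m)%N).

End Weights.
End Euclidean.

(* A chart is a homeomorphism from an open subset of M onto an open subset of
   R^n.  chart_map and chart_inv are total functions, meaningful only on
   chart_dom and chart_im respectively. *)
Record pre_chart (R : realType) (n : nat) (M : Type) := PreChart {
  chart_dom : set M;
  chart_map : M -> 'rV[R]_n;
  chart_inv : 'rV[R]_n -> M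
}.

Definition chart_im (R : realType) (n : nat) (M : Type)
  (c : pre_chart R n M) : set 'rV[R]_n := chart_map c @` chart_dom c.

Section Charts.
Variables (R : realType) (n : nat) (M : topologicalType).
Implicit Types c d : pre_chart R n M.

Definition is_chart c : Prop :=
  [/\ open (chart_dom c), open (chart_im c),
      {in chart_dom c, cancel (chart_map c) (chart_inv c)},
      {in chart_dom c, continuous (chart_map c)} &
      {in chart_im c, continuous (chart_inv c)}].

Definition smooth_transition c d : Prop :=
  smooth_map_on (chart_map c @` (chart_dom c `&` chart_dom d))
    (chart_map d \o chart_inv c).

(* The coordinates F(x_1, ..., x_n), where x = chart_map c and F is a
   diffeomorphism of the open set U onto its image, with inverse G. *)
Definition change_chart c (U : set 'rV[R]_n) (F G : 'rV[R]_n -> 'rV[R]_n) :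
    pre_chart R n M :=
  PreChart (chart_dom c `&` chart_map c @^-1` U)
    (F \o chart_map c) (chart_inv c \o G).

End Charts.

Record smooth_manifold (R : realType) (n : nat) (M : topologicalType) :=
SmoothManifold {
  manifold_hausdorff : hausdorff_space M;
  manifold_second_countable : @second_countable M;
  atlas : set (pre_chart R n M);
  atlas_chart : forall c, atlas c -> is_chart c;
  atlas_cover : forall p : M, exists2 c, atlas c & chart_dom c p;
  atlas_compat : forall c d, atlas c -> atlas d -> smooth_transition c d
}.

Section Tangent.
Variables (R : realType) (n : nat) (M : topologicalType).
Variable A : smooth_manifold R n M.

Definition smooth_fun (U : set M) (f : M -> R) : Prop :=
  forall c, atlas A c ->
    smooth_on (chart_map c @` (chart_dom c `&` U)) (f \o chart_inv c).

Definition smooth_near (p : M) (f : M -> R) : Prop :=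
  exists U, [/\ open U, U p & smooth_fun U f].

(* A tangent vector at p is a derivation on the functions that are smooth near
   p, and a vector field is a family of tangent vectors.  Only the values on
   functions smooth near p are meaningful: two operators which agree on those
   represent the same tangent vector.  The Leibniz rule makes the value on f
   depend only on the germ of f at p. *)
Definition tvec := (M -> R) -> R.
Definition vfield := M -> tvec.

Definition is_tangent (p : M) (v : tvec) : Prop :=
  forall f g, smooth_near p f -> smooth_near p g ->
    (forall a : R, v (fun q => a * f q + g q) = a * v f + v g) /\
    v (fun q => f q * g q) = v f * g p + f p * v g.

(* X is a smooth vector field on the open set U. *)
Definition smooth_vfield (U : set M) (X : vfield) : Prop :=
  (forall p, U p -> is_tangent p (X p)) /\
  forall V f, open V -> V `<=` U -> smooth_fun V f ->
    smooth_fun V (fun p => X p f).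

Definition lie_bracket (X Y : vfield) : vfield :=
  fun p f => X p (fun q => Y q f) - Y p (fun q => X q f).

Definition lin_indep_at (p : M) (k : nat) (v : 'I_k -> tvec) : Prop :=
  forall c : 'I_k -> R,
    (forall f, smooth_near p f -> \sum_i c i * v i f = 0) ->
    forall i, c i = 0.

Definition span_at (p : M) (k : nat) (v : 'I_k -> tvec) : set tvec :=
  [set u | exists c : 'I_k -> R,
     forall f, smooth_near p f -> u f = \sum_i c i * v i f].

(* Smooth frame over the open set U of a family E of subspaces of the tangent
   spaces. *)
Definition is_frame (E : M -> set tvec) (U : set M) (k : nat)
    (X : 'I_k -> vfield) : Prop :=
  (forall i, smooth_vfield U (X i)) /\
  forall p, U p ->
    lin_indep_at p (fun i => X i p) /\ E p = span_at p (fun i => X i p).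

Definition is_subbundle (k : nat) (E : M -> set tvec) : Prop :=
  forall p, exists U (X : 'I_k -> vfield),
    [/\ open U, U p & is_frame E U X].

Definition is_section (E : M -> set tvec) (U : set M) (X : vfield) : Prop :=
  smooth_vfield U X /\ forall p, U p -> E p (X p).

(* c is a system of local coordinates centered at p, that is, a chart of the
   maximal atlas around p which maps p to 0. *)
Definition centered_coordinates (p : M) (c : pre_chart R n M) : Prop :=
  [/\ is_chart c,
      forall d, atlas A d -> smooth_transition c d /\ smooth_transition d c,
      chart_dom c p & chart_map c p = 0].

End Tangent.

(* Only the H_i with 1 <= i <= r are meaningful. *)
Record carnot_manifold (R : realType) (n : nat) (M : topologicalType)
    (A : smooth_manifold R n M) (r : nat) := CarnotManifold {
  carnot_H : nat -> M -> set (tvec R M);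
  carnot_rank : nat -> nat;
  carnot_step_gt0 : (0 < r)%N;
  carnot_subbundle : forall i, (0 < i <= r)%N ->
    is_subbundle A (carnot_rank i) (carnot_H i);
  carnot_filtration : forall i, (0 < i < r)%N ->
    forall p, carnot_H i p `<=` carnot_H i.+1 p;
  carnot_top : forall p, carnot_H r p = is_tangent A p;
  carnot_bracket : forall i j, (0 < i)%N -> (0 < j)%N -> (i + j <= r)%N ->
    forall U X Y, open U ->
      is_section A (carnot_H i) U X -> is_section A (carnot_H j) U Y ->
      is_section A (carnot_H (i + j)%N) U (lie_bracket X Y)
}.

Section Carnot.
Variables (R : realType) (n : nat) (M : topologicalType).
Variables (A : smooth_manifold R n M) (r : nat) (H : carnot_manifold A r).

(* w_j = min {i in {1, ..., r} : j <= rk H_i}; as 'I_n starts at 0, the index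
   j : 'I_n stands for j + 1. *)
Definition is_weight_sequence (w : 'I_n -> nat) : Prop :=
  forall j : 'I_n,
    [/\ (0 < w j <= r)%N, (j.+1 <= carnot_rank H (w j))%N &
        forall i, (0 < i <= r)%N -> (j.+1 <= carnot_rank H i)%N ->
          (w j <= i)%N].

Variable w : 'I_n -> nat.

Definition H_frame (U : set M) (X : 'I_n -> vfield R M) : Prop :=
  is_frame A (is_tangent A) U X /\
  forall j, is_section A (carnot_H H (w j)) U (X j).

End Carnot.

Section Privileged.
Variables (R : realType) (n : nat) (M : topologicalType).
Variables (A : smooth_manifold R n M) (w : 'I_n -> nat).
Variables (X : 'I_n -> vfield R M) (a : M).

(* X_I f = X_{i_1} ... X_{i_k} f *)
Definition word_action (I : seq 'I_n) (f : M -> R) : M -> R :=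
  foldr (fun i g p => X i p g) f I.

Definition word_weight (I : seq 'I_n) : nat := (\sum_(i <- I) w i)%N.

Definition order_ge (f : M -> R) (N : nat) : Prop :=
  forall I, (word_weight I < N)%N -> word_action I f a = 0.

Definition has_order (f : M -> R) (N : nat) : Prop :=
  order_ge f N /\ exists2 I, word_weight I = N & word_action I f a != 0.

Definition linearly_adapted (c : pre_chart R n M) : Prop :=
  forall j f, smooth_near A a f ->
    X j a f = partial j (f \o chart_inv c) 0.

Definition privileged (c : pre_chart R n M) : Prop :=
  [/\ centered_coordinates A a c, linearly_adapted c &
      forall k, has_order (fun p => chart_map c p 0 k) (w k)].

End Privileged.

(* Main.v *)
From HB Require Import structures.
Require Import Defs.
From mathcomp Require Import all_boot all_order all_algebra.
From mathcomp Require Import all_classical all_reals all_analysis.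
From mathcomp Require Import -(notations) mpoly.
From mathcomp Require Import ring lra zify.

Set Implicit Arguments.
Unset Strict Implicit.
Unset Printing Implicit Defensive.

Import Order.TTheory GRing.Theory Num.Theory.
Import numFieldNormedType.Exports.
Local Open Scope classical_set_scope.
Local Open Scope ring_scope.

(* Say that a smooth function on R^n vanishes to weighted order N at 0 if all its
   coordinate partial derivatives of weighted degree < N vanish at 0.

   In privileged coordinates this agrees with the order defined by the frame.  A
   frame spans all derivations, so X_j = sum_k b_jk d_k with b_jk = X_j x_k, where
   b_jk has order >= w_k - w_j and b_jk(0) = delta_jk; the two notions are then
   compared by induction on N, solving X_j f = sum_k b_jk d_k f for d_j f
   downwards in the weight w_j.

   On R^n, vanishing to weighted order N is equivalent to being O(||x||^N): one
   direction is the mean value theorem along the segment from 0 to x, the other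
   compares the lowest weighted homogeneous Taylor polynomial p of f with f along
   dilations.

   So y = phi(x) is privileged iff phi'(0) = id and phi_k vanishes to weighted
   order w_k, and phihat_k is the Taylor polynomial of phi_k of weight w_k.  It is
   x_k plus a polynomial in the variables of weight < w_k, so phihat is invertible
   with polynomial inverse. *)

(** * Smooth functions on R^n *)

Section Locality.
Variables (R : realType) (n : nat).
Implicit Types (f g : 'rV[R]_n -> R) (U : set 'rV[R]_n).

Lemma near_open (T : topologicalType) (A : set T) (P : T -> Prop) (x : T) :
  open A -> A x -> (forall y, A y -> P y) -> \forall y \near x, P y.
Proof. by move=> oA Ax AP; apply: filterS (open_nbhs_nbhs (conj oA Ax)). Qed.

Lemma eq_continuous_at (S T : topologicalType) (A : set S) (f g : S -> T) x :
  open A -> A x -> (forall x, A x -> f x = g x) ->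
  {for x, continuous f} -> {for x, continuous g}.
Proof.
move=> oA Ax fg cf; rewrite /prop_for /continuous_at -fg//.
apply: cvg_trans cf; apply: near_eq_cvg.
by apply: near_open oA Ax _.
Qed.

Lemma partials_rcons s i f : partials (rcons s i) f = partials s (partial i f).
Proof. exact: foldr_rcons. Qed.

Lemma eq_partials_on U f g : open U -> (forall x, U x -> f x = g x) ->
  forall s x, U x -> partials s f x = partials s g x.
Proof.
move=> oU fg; elim=> [|i s IH] x Ux /=; first exact: fg.
by apply: near_eq_derive; apply: near_open oU Ux _.
Qed.

Lemma eq_smooth_on U f g : open U -> (forall x, U x -> f x = g x) ->
  smooth_on U f -> smooth_on U g.
Proof.
move=> oU fg sf s x Ux; have [cf df] := sf s x Ux.
have e := eq_partials_on oU fg s.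
split; first exact: eq_continuous_at oU Ux e cf.
move=> i; apply: near_eq_derivable (df i).
by apply: near_open oU Ux _.
Qed.

Lemma sub_smooth_on U V f : V `<=` U -> smooth_on U f -> smooth_on V f.
Proof. by move=> VU sf s x /VU; exact: sf. Qed.

Lemma smooth_on_partial U i f : smooth_on U f -> smooth_on U (partial i f).
Proof. by move=> sf s x Ux; rewrite -partials_rcons; exact: sf. Qed.

(** A way to prove smoothness without computing higher derivatives: it suffices to find a class [S]
    that is stable under [partial], up to equality on [U]. The induction strips the innermost
    derivative of the word, which leads back into [S]. *)
Lemma smooth_on_coind (S : ('rV[R]_n -> R) -> Prop) U : open U ->
  (forall f, S f -> forall x, U x -> {for x, continuous f} /\
     forall i, derivable f x (delta_mx 0 i)) ->
  (forall f, S f -> forall i, exists2 g, S g &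
     forall x, U x -> partial i f x = g x) ->
  forall f, S f -> smooth_on U f.
Proof.
move=> oU S0 S1 f Sf s; elim/last_ind: s f Sf => [|s i IH] f Sf x Ux.
  exact: S0.
have [g Sg fg] := S1 _ Sf i; rewrite partials_rcons.
have {}fg x' (Ux' : U x') : g x' = partial i f x' by rewrite fg.
have e := eq_partials_on oU fg s.
have [cf df] := IH _ Sg x Ux.
split; first exact: eq_continuous_at oU Ux e cf.
move=> j; apply: near_eq_derivable (df j).
by apply: near_open oU Ux _.
Qed.

End Locality.

(** * Derivatives along lines *)

Section Directional.
Variables (R : realType) (V : normedModType R).
Implicit Types (f : V -> R) (x v : V).

Lemma is_derive_line f x v (t : R) : derivable f (x + t *: v) v ->
  is_derive t 1 (fun s : R => f (x + s *: v)) ('D_v f (x + t *: v)).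
Proof.
move=> df.
have E : (fun h : R => h^-1 *: (((fun s : R => f (x + s *: v)) \o shift t)
     (h *: 1) - f (x + t *: v))) =
   (fun h : R => h^-1 *: ((f \o shift (x + t *: v)) (h *: v) - f (x + t *: v))).
  apply/funext => h /=; congr (_ *: (f _ - _)).
  by rewrite [h *: 1]mulr1 scalerDl addrCA addrC addrAC addrC.
by split; rewrite /derivable /derive E.
Qed.

Lemma mvt_line f x v :
  (forall t : R, 0 <= t <= 1 -> derivable f (x + t *: v) v) ->
  exists2 t : R, 0 <= t <= 1 & f (x + v) - f x = 'D_v f (x + t *: v).
Proof.
move=> df; have [||t] := @MVT_segment R (fun s => f (x + s *: v))
    (fun s => 'D_v f (x + s *: v)) 0 1 ler01.
- move=> t; rewrite in_itv /= => /andP[/ltW t0 /ltW t1].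
  by apply: is_derive_line; apply: df; rewrite t0.
- apply: derivable_within_continuous => t; rewrite in_itv /= => /df h.
  exact: (@ex_derive _ _ _ _ _ _ _ (is_derive_line h)).
rewrite in_itv /= => t01; rewrite scale1r scale0r addr0 subr0 mulr1 => e.
by exists t.
Qed.

(** Only derivability along [v] is available here, so linearity of a differential cannot be invoked.
    The one-variable chain rule for s -> s a replaces it and covers a = 0 without a case split. *)
Lemma is_derive_scale f x v (a : R) : derivable f x v ->
  is_derive x (a *: v) f (a * 'D_v f x).
Proof.
move=> df; have df0 : derivable f (x + 0 *: v) v by rewrite scale0r addr0.
have := is_derive_line df0; rewrite scale0r addr0 => dg.
have dm : is_derive (0 : R) (1 : R) (fun s : R => s * a) a.
  have := @is_deriveM _ _ id (cst a) 0 1 1 0 _ _.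
  rewrite /= [_ *: 0]scaler0 add0r => h.
  by apply: (is_derive_eq (h _ _)); rewrite [_ *: _]mulr1.
have dg' : is_derive (0 * a) 1 (fun s : R => f (x + s *: v)) ('D_v f x).
  by rewrite mul0r.
have h := @is_derive1_comp _ (fun s : R => f (x + s *: v)) ( *%R^~ a) 0 _ _ dg' dm.
have E : (fun h : R => h^-1 *: (((fun s : R => f (x + s *: v)) \o ( *%R^~ a)
      \o shift 0) (h *: 1) - ((fun s : R => f (x + s *: v)) \o ( *%R^~ a)) 0)) =
   (fun h : R => h^-1 *: ((f \o shift x) (h *: (a *: v)) - f x)).
  apply/funext => s /=; rewrite mul0r scale0r !addr0 [s *: 1]mulr1 scalerA.
  by rewrite [_ + x]addrC.
case: h; rewrite /derivable /derive => h1 h2.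
split.
  by rewrite /derivable -E.
by rewrite /derive -E h2 mulrC.
Qed.

End Directional.

Section RowNorm.
Variables (R : realType) (n : nat).
Implicit Types v : 'rV[R]_n.

Lemma row_norm_le v (c : R) : 0 <= c -> (forall j, `|v 0 j| <= c) -> `|v| <= c.
Proof.
move=> c0 vc; rewrite [leLHS]/Num.Def.normr/= mx_normrE.
by rewrite (bigmax_le _ c0)//= => -[i j] _ /=; rewrite ord1.
Qed.

Lemma coord_le_row_norm v j : `|v 0 j| <= `|v|.
Proof.
rewrite [leRHS]/Num.Def.normr/= mx_normrE.
exact: (le_bigmax _ (fun ij : 'I_1 * 'I_n => `|v ij.1 ij.2|) (0, j)).
Qed.

End RowNorm.

(** * Continuous partial derivatives imply differentiability *)

Section C1.
Variables (R : realType) (n : nat).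
Implicit Types (f : 'rV[R]_n -> R) (U : set 'rV[R]_n).

(** With [c] the partial derivatives at a point, this is the candidate for the differential
    there. *)
Definition linform (c : 'I_n -> R) (h : 'rV[R]_n) : R := \sum_i h 0 i * c i.

Lemma linform_is_linear c : linear (linform c).
Proof.
move=> a u v; rewrite /linform scaler_sumr -big_split; apply: eq_bigr => i _ /=.
by rewrite !mxE mulrDl -mulrA.
Qed.

HB.instance Definition _ c :=
  GRing.isLinear.Build R 'rV[R]_n R *:%R (linform c) (linform_is_linear c).

Lemma linform_continuous c : continuous (linform c).
Proof.
apply: continuous_big => [|i _ y]; first exact: add_continuous.
by apply: (@continuousM _ _ (fun h : 'rV[R]_n => h 0 i) (cst (c i)));
  [exact: coord_continuous|exact: cst_continuous].
Qed.

(** Relates consecutive corners of the path from 0 to h that follows one coordinate axis at a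
    time. *)
Lemma row_prefixS (h : 'rV[R]_n) (i : 'I_n) :
  \row_j (if (j < i.+1)%N then h 0 j else 0) =
  \row_j (if (j < i)%N then h 0 j else 0) + h 0 i *: delta_mx 0 i.
Proof.
apply/rowP => j; rewrite !mxE eqxx /= ltnS leq_eqVlt.
have [->|ji] := eqVneq j i; first by rewrite eqxx ltnn mulr1 add0r.
by rewrite mulr0 addr0 (inj_eq val_inj) (negbTE ji).
Qed.

(* Continuous partial derivatives: move from x to x + h one coordinate at a time
   and apply the mean value theorem to each step. *)
Lemma differentiable_partial U f x : open U -> U x ->
  (forall y i, U y -> derivable f y (delta_mx 0 i)) ->
  (forall i, {for x, continuous (partial i f)}) ->
  differentiable f x /\ forall h, 'd f x h = \sum_i h 0 i * partial i f x.
Proof.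
move=> oU Ux df cf; pose L := linform (fun i => partial i f x).
suff E : f \o shift x = cst (f x) + L +o_ (0 : 'rV[R]_n) id.
  have dE := diff_unique (@linform_continuous _) E.
  split; last by move=> h; rewrite dE.
  apply/diff_locallyP; rewrite dE; split => //; exact: linform_continuous.
(* The error is shared among the n coordinate steps; dividing by [n.+1] keeps [e'] positive when n =
   0. *)
apply/eqaddoP => e e0; pose e' := e / n.+1%:R.
have e'0 : 0 < e' by rewrite divr_gt0.
have : \forall y \near x, U y /\ forall i, `|partial i f x - partial i f y| <= e'.
  apply: filterI; first exact: (open_nbhs_nbhs (conj oU Ux)).
  apply: (@filter_forall _ _ _ (nbhs x) _) => i.
  exact: ((cvgrPdist_le _ _).1 (cf i)).
move=> /nbhs_normP[d /= d0 dP].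
suff : nbhs (0 : 'rV[R]_n) (fun h => `|(f \o shift x - (cst (f x) + L)) h| <= e * `|h|).
  by [].
apply/(@nbhs_normP _ 'rV[R]_n (0 : 'rV[R]_n)); exists d => //= h.
rewrite /ball_/= sub0r normrN => hd.
pose P k : 'rV[R]_n := \row_j (if (j < k)%N then h 0 j else 0).
have Pn : P n = h by apply/rowP => j; rewrite mxE ltn_ord.
have P0 : P 0%N = 0 by apply/rowP => j; rewrite !mxE.
have tel : f (h + x) - f x = \sum_(i < n) (f (x + P i.+1) - f (x + P i)).
  rewrite -(big_mkord predT (fun i => f (x + P i.+1) - f (x + P i))).
  by rewrite telescope_sumr// Pn P0 addr0 [x + h]addrC.
have step (i : 'I_n) :
    `|f (x + P i.+1) - f (x + P i) - h 0 i * partial i f x| <= e' * `|h|.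
  pose v : 'rV[R]_n := h 0 i *: delta_mx 0 i.
  (* Each coordinate of [P i + t *: v] is at most that of [h] in absolute value, so in the sup norm
     the whole path stays in the ball. *)
  have inb (t : R) : 0 <= t <= 1 -> `|x - (x + P i + t *: v)| < d.
    move=> /andP[t0 t1]; apply: le_lt_trans hd; rewrite -addrA opprD addNKr normrN.
    apply: row_norm_le => // j; rewrite !mxE eqxx /=.
    have := coord_le_row_norm h j.
    have [->|ji] := eqVneq j i.
      rewrite ltnn add0r mulr1; apply: le_trans; rewrite normrM ger0_norm//.
      by rewrite ler_piMl.
    by rewrite !mulr0 addr0; case: ifP => // _ _; rewrite normr0.
  have dv t : 0 <= t <= 1 -> is_derive (x + P i + t *: v) v f
      (h 0 i * partial i f (x + P i + t *: v)).
    by move=> /inb /dP[Uy _]; apply: is_derive_scale; exact: df.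
  have -> : P i.+1 = P i + v by exact: row_prefixS.
  rewrite addrA.
  have [t /[dup] t01 /inb /dP [_ bnd] ->] := mvt_line (fun t h => @ex_derive _ _ _ _ _ _ _ (dv t h)).
  have -> := @derive_val _ _ _ _ _ _ _ (dv t t01).
  rewrite -mulrBr normrM mulrC ler_pM// ?coord_le_row_norm//.
  by rewrite distrC.
rewrite !fctE /=.
have -> : f (h + x) - (f x + L h) =
    \sum_(i < n) (f (x + P i.+1) - f (x + P i) - h 0 i * partial i f x).
  by rewrite opprD addrA tel -sumrB.
apply: le_trans (ler_norm_sum _ _ _) _.
apply: (@le_trans _ _ (\sum_(i < n) e' * `|h|)); first exact: ler_sum.
rewrite sumr_const card_ord -mulr_natl mulrA ler_wpM2r//.
rewrite /e' mulrCA ger_pMr// ler_pdivrMr// mul1r ler_nat.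
by [].
Qed.

Lemma smooth_on_diff U f x : open U -> smooth_on U f -> U x ->
  differentiable f x /\ forall h, 'd f x h = \sum_i h 0 i * partial i f x.
Proof.
move=> oU sf Ux; apply: (differentiable_partial oU Ux) => [y i Uy|i].
  exact: (sf [::] y Uy).2.
exact: (sf [:: i] x Ux).1.
Qed.

Lemma is_derive_smooth U f x v : open U -> smooth_on U f -> U x ->
  is_derive x v f (\sum_i v 0 i * partial i f x).
Proof.
move=> oU sf Ux; have [df dE] := smooth_on_diff oU sf Ux.
by split; [exact: diff_derivable|rewrite deriveE// dE].
Qed.

End C1.

(** * Chain rule and closure properties of smooth functions *)

Section SmoothAlgebra.
Variables (R : realType) (n : nat).
Implicit Types (f g F : 'rV[R]_n -> R) (G : 'rV[R]_n -> 'rV[R]_n).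
Implicit Types (U W : set 'rV[R]_n).

Lemma smooth_on_continuous U f x : smooth_on U f -> U x -> {for x, continuous f}.
Proof. by move=> sf Ux; exact: (sf [::] x Ux).1. Qed.

Lemma smooth_on_derivable U f x i : smooth_on U f -> U x ->
  derivable f x (delta_mx 0 i).
Proof. by move=> sf Ux; exact: (sf [::] x Ux).2. Qed.

Lemma smooth_on_cst U (c : R) : open U -> smooth_on U (fun=> c).
Proof.
move=> oU; apply: (@smooth_on_coind _ _ (fun f => exists c, f = cst c)) => //.
- by move=> _ [{}c ->] x _; split => [|i]; [exact: cst_continuous|exact: derivable_cst].
- move=> _ [{}c ->] i; exists (cst 0); first by exists 0.
  by move=> x _; rewrite /partial derive_cst.
- by exists c.
Qed.

Lemma differentiable_row G x :
  (forall k, differentiable (fun y => G y 0 k) x) -> differentiable G x.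
Proof.
move=> dG; have -> : G = \sum_(k < n) (fun y => G y 0 k *: delta_mx 0 k).
  by apply/funext => y; rewrite fct_sumE; exact: row_sum_delta.
by apply: differentiable_sum => k; exact: differentiableZl.
Qed.

Lemma smooth_map_differentiable U G x : open U -> smooth_map_on U G -> U x ->
  differentiable G x.
Proof.
by move=> oU sG Ux; apply: differentiable_row => k; exact: (smooth_on_diff oU (sG k) Ux).1.
Qed.

Lemma diff_row G x v k : differentiable G x ->
  'd G x v 0 k = 'D_v (fun y => G y 0 k) x.
Proof.
move=> dG; rewrite -deriveE// derive_mx; last exact: diff_derivable.
by rewrite mxE.
Qed.

Lemma is_derive_comp U W F G x v : open U -> open W ->
  smooth_on W F -> smooth_map_on U G -> U x -> W (G x) ->
  is_derive x v (F \o G)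
    (\sum_k 'D_v (fun y => G y 0 k) x * partial k F (G x)).
Proof.
move=> oU oW sF sG Ux WGx.
have dG := smooth_map_differentiable oU sG Ux.
have [dF dFE] := smooth_on_diff oW sF WGx.
have dFG : differentiable (F \o G) x by exact: differentiable_comp.
split; first exact: diff_derivable.
rewrite (deriveE v dFG); have -> : 'd (F \o G) x v = 'd F (G x) ('d G x v).
  exact: (congr1 (fun h => h v) (diff_comp dG dF)).
by rewrite dFE; apply: eq_bigr => k _; rewrite diff_row.
Qed.

Lemma partial_comp U W F G x j : open U -> open W ->
  smooth_on W F -> smooth_map_on U G -> U x -> W (G x) ->
  partial j (F \o G) x =
  \sum_k partial j (fun y => G y 0 k) x * partial k F (G x).
Proof.
move=> oU oW sF sG Ux WGx.
exact: (@derive_val _ _ _ _ _ _ _ (is_derive_comp (delta_mx 0 j) oU oW sF sG Ux WGx)).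
Qed.

(** Used twice for mutually inverse [phi] and [psi]: to derive psi'(0) = id from phi'(0) = id, and
    to transfer linear adaptedness to the new chart. *)
Lemma partial_comp_tangent_id U W F G x j : open U -> open W ->
  smooth_on W F -> smooth_map_on U G -> U x -> W (G x) ->
  (forall i k, partial i (fun y => G y 0 k) x = (i == k)%:R) ->
  partial j (F \o G) x = partial j F (G x).
Proof.
move=> oU oW sF sG Ux WGx dG; rewrite (partial_comp j oU oW sF sG Ux WGx).
rewrite (bigD1 j)//= dG eqxx mul1r big1 ?addr0// => k kj.
by rewrite dG eq_sym (negbTE kj) mul0r.
Qed.

(** A partial derivative of F o G is a sum of products of smooth functions with composites (d_k F) o
    G. Composites alone are thus not stable under differentiation, but they are once closed under
    sums and products, and [smooth_on_coind] then applies. *)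
Inductive smooth_gen U : ('rV[R]_n -> R) -> Prop :=
| smooth_gen_base f : smooth_on U f -> smooth_gen U f
| smooth_gen_comp W F G : open W -> smooth_on W F -> smooth_map_on U G ->
    (forall x, U x -> W (G x)) -> smooth_gen U (F \o G)
| smooth_gen_add f g : smooth_gen U f -> smooth_gen U g -> smooth_gen U (f + g)
| smooth_gen_mul f g : smooth_gen U f -> smooth_gen U g -> smooth_gen U (f * g).

Lemma smooth_gen_smooth U f : open U -> smooth_gen U f -> smooth_on U f.
Proof.
move=> oU; have base h : smooth_gen U h -> forall x, U x ->
    {for x, continuous h} /\ forall i, derivable h x (delta_mx 0 i).
  elim=> {h} [h sh x Ux|W F G oW sF sG UW x Ux|h g _ IHh _ IHg x Ux|h g _ IHh _ IHg x Ux].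
  - exact: (sh [::] x Ux).
  - split; last by move=> i; have [] := is_derive_comp (delta_mx 0 i) oU oW sF sG Ux (UW _ Ux).
    apply: continuous_comp; last exact: smooth_on_continuous sF (UW _ Ux).
    exact/differentiable_continuous/(smooth_map_differentiable oU sG Ux).
  - have [ch dh] := IHh x Ux; have [cg dg] := IHg x Ux.
    by split; [exact: continuousD|move=> i; exact: derivableD].
  - have [ch dh] := IHh x Ux; have [cg dg] := IHg x Ux.
    by split; [exact: continuousM|move=> i; exact: derivableM].
move=> sgf; apply: (smooth_on_coind oU base _ sgf) => {sgf}.
move=> {}f; elim=> {f} [f sf|W F G oW sF sG UW|f g sf IHf sg IHg|f g sf IHf sg IHg] i.
- by exists (partial i f) => //; apply: smooth_gen_base; exact: smooth_on_partial.
- exists (\sum_k partial i (fun y => G y 0 k) * (partial k F \o G)).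
    elim/big_ind: _ => [||k _]; last 1 first.
    - apply: smooth_gen_mul; first exact/smooth_gen_base/smooth_on_partial.
      exact: smooth_gen_comp oW (smooth_on_partial k sF) sG UW.
    - exact/smooth_gen_base/smooth_on_cst.
    - exact: smooth_gen_add.
  by move=> x Ux; rewrite fct_sumE; exact: partial_comp oU oW sF sG Ux (UW _ Ux).
- have [f' sf' ff'] := IHf i; have [g' sg' gg'] := IHg i.
  exists (f' + g'); first exact: smooth_gen_add.
  move=> x Ux; rewrite /partial deriveD; last 2 first.
  - exact: (base _ sf _ Ux).2.
  - exact: (base _ sg _ Ux).2.
  by rewrite -/(partial i f x) -/(partial i g x) ff'// gg'.
- have [f' sf' ff'] := IHf i; have [g' sg' gg'] := IHg i.
  exists (f * g' + g * f').
    by apply: smooth_gen_add; exact: smooth_gen_mul.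
  move=> x Ux; rewrite /partial deriveM; last 2 first.
  - exact: (base _ sf _ Ux).2.
  - exact: (base _ sg _ Ux).2.
  by rewrite -/(partial i f x) -/(partial i g x) ff'// gg'.
Qed.

Lemma smooth_onD U f g : open U -> smooth_on U f -> smooth_on U g ->
  smooth_on U (fun x => f x + g x).
Proof.
move=> oU sf sg; apply: (smooth_gen_smooth oU).
by apply: smooth_gen_add; exact: smooth_gen_base.
Qed.

Lemma smooth_onM U f g : open U -> smooth_on U f -> smooth_on U g ->
  smooth_on U (fun x => f x * g x).
Proof.
move=> oU sf sg; apply: (smooth_gen_smooth oU).
by apply: smooth_gen_mul; exact: smooth_gen_base.
Qed.

Lemma smooth_onB U f g : open U -> smooth_on U f -> smooth_on U g ->
  smooth_on U (fun x => f x - g x).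
Proof.
move=> oU sf sg; apply: (eq_smooth_on (f := fun x => f x + -1 * g x) oU).
  by move=> x _; rewrite mulN1r.
exact: smooth_onD oU sf (smooth_onM oU (smooth_on_cst _ oU) sg).
Qed.

Lemma smooth_on_sum U I (r : seq I) (P : pred I) (f : I -> 'rV[R]_n -> R) :
  open U -> (forall i, P i -> smooth_on U (f i)) ->
  smooth_on U (fun x => \sum_(i <- r | P i) f i x).
Proof.
move=> oU sf; elim: r => [|i r IH].
  by apply: (eq_smooth_on oU _ (smooth_on_cst 0 oU)) => x _; rewrite big_nil.
have [Pi|Pi] := boolP (P i).
  apply: (eq_smooth_on oU _ (smooth_onD oU (sf _ Pi) IH)) => x _.
  by rewrite big_cons Pi.
by apply: (eq_smooth_on oU _ IH) => x _; rewrite big_cons (negbTE Pi).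
Qed.

Lemma smooth_on_comp U W F G : open U -> open W -> smooth_on W F ->
  smooth_map_on U G -> (forall x, U x -> W (G x)) -> smooth_on U (F \o G).
Proof.
by move=> oU oW sF sG UW; apply: (smooth_gen_smooth oU); exact: smooth_gen_comp oW _ _ _.
Qed.

Lemma partialD U f g i x : smooth_on U f -> smooth_on U g -> U x ->
  partial i (fun y => f y + g y) x = partial i f x + partial i g x.
Proof. by move=> sf sg Ux; apply: deriveD; apply: smooth_on_derivable Ux. Qed.

Lemma partialB U f g i x : smooth_on U f -> smooth_on U g -> U x ->
  partial i (fun y => f y - g y) x = partial i f x - partial i g x.
Proof. by move=> sf sg Ux; apply: deriveB; apply: smooth_on_derivable Ux. Qed.

Lemma partialM U f g i x : smooth_on U f -> smooth_on U g -> U x ->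
  partial i (fun y => f y * g y) x = partial i f x * g x + f x * partial i g x.
Proof.
move=> sf sg Ux; rewrite /partial.
have -> : 'D_(delta_mx 0 i) (fun y => f y * g y) x = 'D_(delta_mx 0 i) (f * g) x.
  by [].
rewrite deriveM; [|exact: smooth_on_derivable Ux..].
by rewrite addrC [g x *: _]mulrC.
Qed.

End SmoothAlgebra.

(** * Symmetry of iterated partial derivatives *)

Section Schwarz.
Variables (R : realType) (n : nat).
Implicit Types (f : 'rV[R]_n -> R) (U : set 'rV[R]_n).

(** The mean value theorem is applied along [u] to y -> f (y + v) - f y, then along [v] to
    [partial i f]. *)
Lemma second_difference U f x i j (h : R) : open U -> smooth_on U f ->
  (forall y, `|y - x| <= 2 * `|h| -> U y) ->
  let u := h *: delta_mx 0 i in let v := h *: delta_mx 0 j in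
  exists2 y, `|y - x| <= 2 * `|h| &
    f (x + u + v) - f (x + u) - (f (x + v) - f x) =
    h * h * partial j (partial i f) y.
Proof.
move=> oU sf hU u v.
have nd k : `|h *: delta_mx 0 k : 'rV[R]_n| <= `|h|.
  apply: row_norm_le => // l; rewrite !mxE eqxx /=.
  by case: eqP => _; rewrite ?mulr1 ?mulr0 ?normr0.
have near_x (s t : R) : 0 <= s <= 1 -> 0 <= t <= 1 ->
    `|x + s *: u + t *: v - x| <= 2 * `|h|.
  move=> /andP[s0 s1] /andP[t0 t1]; rewrite addrAC [x + _]addrC addrK.
  apply: le_trans (ler_normD _ _) _; rewrite mulr_natl mulr2n.
  apply: lerD; rewrite normrZ ger0_norm//.
    by apply: le_trans (nd i); rewrite ler_piMl.
  by apply: le_trans (nd j); rewrite ler_piMl.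
have sU (s t : R) : 0 <= s <= 1 -> 0 <= t <= 1 -> U (x + s *: u + t *: v).
  by move=> *; apply: hU; exact: near_x.
have z01 : (0 : R) <= (0 : R) <= (1 : R) by rewrite lexx ler01.
have o01 : (0 : R) <= (1 : R) <= (1 : R) by rewrite lexx ler01.
have D k g y : smooth_on U g -> U y -> is_derive y (h *: delta_mx 0 k) g (h * partial k g y).
  by move=> sg Uy; apply: is_derive_scale; exact: smooth_on_derivable Uy.
pose g y := f (y + v) - f y.
have Dg (s : R) : 0 <= s <= 1 -> is_derive (x + s *: u) u g
    (h * (partial i f (x + s *: u + v) - partial i f (x + s *: u))).
  move=> s01; rewrite mulrBr; apply: is_deriveB; last first.
    by apply: D => //; rewrite -[_ + _]addr0 -(scale0r v); exact: sU.
  have [] := D i f (x + s *: u + v) sf _.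
    by rewrite -[v]scale1r; exact: sU.
  have e : (fun t : R => t^-1 *: ((f \o shift (x + s *: u + v)) (t *: u) -
        f (x + s *: u + v))) =
      (fun t => t^-1 *: (((fun y => f (y + v)) \o shift (x + s *: u)) (t *: u) -
        f (x + s *: u + v))) by apply/funext => t /=; rewrite addrA.
  rewrite -/u /derivable /derive e => h1 h2.
  exact: (@DeriveDef _ _ _ _ _ (fun y => f (y + v))).
have [s s01 E] := mvt_line (fun s s01 => @ex_derive _ _ _ _ _ _ _ (Dg s s01)).
have -> : f (x + u + v) - f (x + u) - (f (x + v) - f x) = g (x + u) - g x by [].
rewrite E (@derive_val _ _ _ _ _ _ _ (Dg s s01)).
have Dp (t : R) : 0 <= t <= 1 -> is_derive (x + s *: u + t *: v) v (partial i f)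
    (h * partial j (partial i f) (x + s *: u + t *: v)).
  by move=> t01; apply: D; [exact: smooth_on_partial|exact: sU].
have [t t01 E2] := mvt_line (fun t t01 => @ex_derive _ _ _ _ _ _ _ (Dp t t01)).
exists (x + s *: u + t *: v); first exact: near_x.
by rewrite E2 (@derive_val _ _ _ _ _ _ _ (Dp t t01)) mulrA.
Qed.

Lemma dist_mid (a b p q d : R) : `|a - p| <= d -> `|b - q| <= d -> p = q ->
  `|a - b| <= d + d.
Proof.
move=> ap bq pq; rewrite -(subrKA p) {2}pq.
by apply: le_trans (ler_normD _ _) _; apply: lerD; rewrite // distrC.
Qed.

(** The second difference is symmetric in i and j, so the two mixed derivatives take a common value
    at two points close to x; their continuity at x does the rest. *)
Lemma partialC U f i j x : open U -> smooth_on U f -> U x ->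
  partial i (partial j f) x = partial j (partial i f) x.
Proof.
move=> oU sf Ux; apply/eqP; rewrite -subr_eq0 -normr_le0; apply/ler_addgt0Pr => e e0.
rewrite add0r.
have c k l : {for x, continuous (partial k (partial l f))} by exact: (sf [:: k; l] x Ux).1.
have e20 : 0 < e / 2 by rewrite divr_gt0.
have : \forall y \near x, U y /\
    (`|partial i (partial j f) x - partial i (partial j f) y| <= e / 2 /\
     `|partial j (partial i f) x - partial j (partial i f) y| <= e / 2).
  apply: filterI; first exact: (open_nbhs_nbhs (conj oU Ux)).
  by apply: filterI; [exact: ((cvgrPdist_le _ _).1 (c i j))
                     |exact: ((cvgrPdist_le _ _).1 (c j i))].
move=> /nbhs_normP[d /= d0 dP].
(* The intermediate points lie within 2 h = d / 2 of x, hence inside the ball of radius d. *)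
pose h := d / 4; have h0 : 0 < h by rewrite divr_gt0.
have hd y : `|y - x| <= 2 * `|h| -> ball_ Num.Def.normr x d y.
  rewrite /ball_ /= distrC (gtr0_norm h0) /h => yh; apply: le_lt_trans yh _.
  by rewrite mulrCA gtr_pMr//; lra.
have hU y : `|y - x| <= 2 * `|h| -> U y by move=> /hd /dP[].
have [y1 /hd /dP [_ [_ b1]] E1] := second_difference i j oU sf hU.
have [y2 /hd /dP [_ [b2 _]] E2] := second_difference j i oU sf hU.
have hh : h * h != 0 by rewrite mulf_neq0 ?gt_eqF.
have /(mulfI hh) E : h * h * partial j (partial i f) y1 = h * h * partial i (partial j f) y2.
  have swap (p q r s : R) : p - q - (r - s) = p - r - (q - s) by ring.
  rewrite swap in E2; apply: etrans (esym E1) (etrans _ E2).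
  by congr (f _ - _ - _); exact: addrAC.
by rewrite [e]splitr; exact: dist_mid b2 b1 (esym E).
Qed.

Lemma partials_perm U f (s1 s2 : seq 'I_n) x : open U -> smooth_on U f -> U x ->
  perm_eq s1 s2 -> partials s1 f x = partials s2 f x.
Proof.
move=> oU sf Ux.
have smp s : smooth_on U (partials s f).
  by elim: s => [|i s IH]; [exact: sf|exact: smooth_on_partial].
(* Any letter of the word can be brought to the outermost place by successive transpositions. *)
have front (s : seq 'I_n) i : i \in s -> forall y, U y ->
    partials s f y = partials (i :: rem i s) f y.
  elim: s => // k s IH; rewrite in_cons /=.
  have [->|ik] //= := eqVneq i k.
  move=> /IH {}IH y Uy; rewrite -[RHS]/(partial i (partial k _) y).
  rewrite (partialC _ _ oU (smp _) Uy).
  apply: near_eq_derive; exact: near_open oU Uy IH.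
move: x Ux s2; elim: s1 => [|i s1 IH] x Ux s2.
  by rewrite perm_sym => /perm_small_eq ->.
move=> p; have is2 : i \in s2 by rewrite -(perm_mem p) mem_head.
rewrite (front _ _ is2 x Ux) /=.
apply: near_eq_derive; apply: near_open oU Ux _ => y Uy.
by apply: IH => //; rewrite -(perm_cons i) (permPl p) perm_to_rem.
Qed.

End Schwarz.

(** * Polynomial functions *)

Section PolynomialFunctions.
Variables (R : realType) (n : nat).
Implicit Types (p q : mpoly n R) (x : 'rV[R]_n).

Definition mpolyfun p : 'rV[R]_n -> R := fun x => meval (fun i => x 0 i) p.

Lemma mpolyfunD p q : mpolyfun (p + q) = mpolyfun p + mpolyfun q.
Proof. by apply/funext => x; rewrite /mpolyfun mevalD. Qed.

Lemma mpolyfunM p q : mpolyfun (p * q) = mpolyfun p * mpolyfun q.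
Proof. by apply/funext => x; rewrite /mpolyfun mevalM. Qed.

Lemma mpolyfunC c : mpolyfun (mpolyC n c) = cst c.
Proof. by apply/funext => x; rewrite /mpolyfun mevalC. Qed.

Lemma mpolyfunX i : mpolyfun (mpolyX R (mnm1 i)) = fun x => x 0 i.
Proof. by apply/funext => x; rewrite /mpolyfun mevalXU. Qed.

(** The property [D] holds for constants and variables and passes to sums and products, hence to
    every polynomial written as a sum of monomials. *)
Lemma mpolyfun_derive p x : {for x, continuous (mpolyfun p)} /\
  forall i, is_derive x (delta_mx 0 i) (mpolyfun p) (mpolyfun (mderiv i p) x).
Proof.
pose D (p : mpoly n R) := {for x, continuous (mpolyfun p)} /\
  forall i, is_derive x (delta_mx 0 i) (mpolyfun p) (mpolyfun (mderiv i p) x).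
have DC c : D (mpolyC n c).
  split=> [|i]; first by rewrite mpolyfunC; exact: cst_continuous.
  rewrite mderivC -mpolyC0 !mpolyfunC; exact: is_derive_cst.
have DD (p1 q1 : mpoly n R) : D p1 -> D q1 -> D (p1 + q1).
  move=> [cp dp] [cq dq]; split=> [|i]; rewrite mpolyfunD.
    exact: continuousD.
  by rewrite mderivD mpolyfunD; exact: is_deriveD.
have DM (p1 q1 : mpoly n R) : D p1 -> D q1 -> D (p1 * q1).
  move=> [cp dp] [cq dq]; split=> [|i]; rewrite mpolyfunM.
    exact: continuousM.
  rewrite mderivM mpolyfunD !mpolyfunM; apply: (is_derive_eq (is_deriveM (dp i) (dq i))).
  by rewrite addrC [mpolyfun q1 x *: _]mulrC.
have DX k : D (mpolyX R (mnm1 k)).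
  split=> [|i]; rewrite mpolyfunX; first exact: coord_continuous.
  have dx : differentiable (fun y : 'rV[R]_n => y 0 k) x by exact: differentiable_coord.
  split; first exact: diff_derivable.
  (* As a continuous linear map, the coordinate function is its own differential. *)
  have -> : (fun y : 'rV[R]_n => y 0 k) = linform (fun j => (j == k)%:R).
    apply/funext => y; rewrite /linform (bigD1 k)//= eqxx mulr1 big1 ?addr0// => j jk.
    by rewrite (negbTE jk) mulr0.
  rewrite deriveE; last exact/linear_differentiable/linform_continuous.
  rewrite diff_lin; last exact: linform_continuous.
  rewrite mderivX mnm1E [LHS]/= /linform (bigD1 i)//= mxE !eqxx mul1r big1 ?addr0; last first.
    by move=> j ji; rewrite mxE eqxx (negbTE ji) mul0r.
  rewrite /mpolyfun mevalZ eq_sym; have [->|_] := eqVneq k i; last by rewrite mul0r.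
  have -> : mnm_sub (mnm1 i) (mnm1 i) = mnm0 by apply/mnmP => j; rewrite mnmBE subnn mnm0E.
  by rewrite mpolyX0 meval1 mulr1.
rewrite -/(D p) (mpolyE p); apply: (big_ind D) => //; first by rewrite -mpolyC0.
move=> m _; rewrite -mul_mpolyC; apply: (DM) => //; rewrite mpolyXE_id.
apply: (big_ind D); [by rewrite -mpolyC1; exact: DC|exact: DM|move=> i _].
elim: (m i) => [|k IH]; first by rewrite expr0 -mpolyC1; exact: DC.
by rewrite exprS; exact: DM.
Qed.

Lemma partial_mpolyfun i p : partial i (mpolyfun p) = mpolyfun (mderiv i p).
Proof.
apply/funext => x.
exact: (@derive_val _ _ _ _ _ _ _ ((mpolyfun_derive p x).2 i)).
Qed.

Lemma partials_mpolyfun s p : partials s (mpolyfun p) = mpolyfun (foldr (@mderiv n R) p s).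
Proof. by elim: s => //= i s ->; exact: partial_mpolyfun. Qed.

Lemma mpolyfun_smooth p : smooth_on setT (mpolyfun p).
Proof.
apply: (@smooth_on_coind _ _ (fun f => exists p, f = mpolyfun p)) => //.
- exact: openT.
- move=> _ [{}p ->] x _; have [cp dp] := mpolyfun_derive p x.
  by split => // i; exact: (@ex_derive _ _ _ _ _ _ _ (dp i)).
- move=> _ [{}p ->] i; exists (mpolyfun (mderiv i p)); first by exists (mderiv i p).
  by move=> x _; rewrite partial_mpolyfun.
- by exists p.
Qed.

Lemma mpolyfun0 p : mpolyfun p 0 = mcoeff mnm0 p.
Proof.
rewrite /mpolyfun mevalE.
have z (m : multinom n) : \prod_(i < n) (0 : 'rV[R]_n) 0 i ^+ m i = (m == mnm0 :> multinom n)%:R.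
  have [->|m0] := eqVneq m mnm0; first by rewrite big1// => i _; rewrite mnm0E.
  have [i mi] : exists i, m i != 0%N.
    apply/existsP; apply: contraR m0 => /existsPn h; apply/eqP/mnmP => i.
    by rewrite mnm0E; apply/eqP; rewrite -[_ == _]negbK h.
  by rewrite (bigD1 i)//= mxE expr0n (negbTE mi) mul0r.
under eq_bigr do rewrite z.
have [p0|p0] := boolP (mnm0 \in msupp p).
  rewrite (bigD1_seq _ p0) ?msupp_uniq//= eqxx mulr1 big1 ?addr0// => m /negbTE ->.
  by rewrite mulr0.
rewrite (memN_msupp_eq0 p0) big1_seq// => m /andP[_ mp].
by case: eqP mp => [->|_ _]; rewrite ?(negbTE p0)// mulr0.
Qed.

(** Iterated derivatives are indexed by words and monomials by multi-indices. By symmetry of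
    derivatives only the letter counts matter; [word_of_mnm] picks one word for each multi-index. *)
Definition mnm_of_word (s : seq 'I_n) : multinom n :=
  Multinom [tuple count_mem i s | i < n].

Definition word_of_mnm (a : multinom n) : seq 'I_n :=
  flatten [seq nseq (a i) i | i <- enum 'I_n].

Lemma perm_word_of_mnm s : perm_eq s (word_of_mnm (mnm_of_word s)).
Proof.
apply/allP => i _; apply/eqP; rewrite count_flatten sumnE !big_map -/(index_enum _).
rewrite (bigD1 i)//= count_nseq /= eqxx mul1n mnmE big1 ?addn0// => j ji.
by rewrite count_nseq /= (negbTE ji).
Qed.

Lemma foldr_mderiv s p : foldr (@mderiv n R) p s = mderivm (mnm_of_word s) p.
Proof. by rewrite mderivm_foldr; apply/mderiv_perm/perm_word_of_mnm. Qed.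

End PolynomialFunctions.

(** * Weighted order of vanishing *)

Section WeightedVanishing.
Variables (R : realType) (n : nat) (w : 'I_n -> nat).
Hypothesis w_gt0 : forall j, (0 < w j)%N.
Implicit Types (f g : 'rV[R]_n -> R) (U : set 'rV[R]_n).

Definition vanishes f (N : nat) :=
  forall s, (word_weight w s < N)%N -> partials s f 0 = 0.

Lemma word_weight_rcons s j : word_weight w (rcons s j) = (word_weight w s + w j)%N.
Proof. by rewrite /word_weight -cats1 big_cat big_seq1. Qed.

Lemma vanishes_partial f N j : vanishes f N -> vanishes (partial j f) (N - w j).
Proof.
move=> vf s sN; rewrite -partials_rcons; apply: vf.
by rewrite word_weight_rcons; move: sN; rewrite ltn_subRL addnC.
Qed.

(** The recursive form of the weighted order, on which the inductions below run. Truncated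
    subtraction is harmless: order 0 is an empty condition, as it should be when w_j >= N. *)
Lemma vanishes_intro f N : ((0 < N)%N -> f 0 = 0) ->
  (forall j, vanishes (partial j f) (N - w j)) -> vanishes f N.
Proof.
move=> f0 vf; elim/last_ind => [|s j _]; first by rewrite /word_weight big_nil.
rewrite word_weight_rcons partials_rcons => sN; apply: vf.
by rewrite ltn_subRL addnC.
Qed.

Lemma vanishes_at0 f N : (0 < N)%N -> vanishes f N -> f 0 = 0.
Proof. by move=> N0 vf; apply: (vf [::]); rewrite /word_weight big_nil. Qed.

Lemma eq_vanishes U f g N : open U -> U 0 -> (forall x, U x -> f x = g x) ->
  vanishes f N -> vanishes g N.
Proof. by move=> oU U0 fg vf s /vf <-; exact/esym/(eq_partials_on oU fg). Qed.

Lemma partials_add U f g (s : seq 'I_n) x : open U -> smooth_on U f -> smooth_on U g -> U x ->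
  partials s (fun y => f y + g y) x = partials s f x + partials s g x.
Proof.
move=> oU sf sg Ux; elim/last_ind: s f g sf sg => [//|s j IH] f g sf sg.
rewrite !partials_rcons -IH; [|exact: smooth_on_partial..].
by apply: (eq_partials_on oU) => // y Uy; exact: partialD Uy.
Qed.

Lemma partials_sub U f g (s : seq 'I_n) x : open U -> smooth_on U f -> smooth_on U g -> U x ->
  partials s (fun y => f y - g y) x = partials s f x - partials s g x.
Proof.
move=> oU sf sg Ux; elim/last_ind: s f g sf sg => [//|s j IH] f g sf sg.
rewrite !partials_rcons -IH; [|exact: smooth_on_partial..].
by apply: (eq_partials_on oU) => // y Uy; exact: partialB Uy.
Qed.

Lemma vanishesD U f g N : open U -> U 0 -> smooth_on U f -> smooth_on U g ->
  vanishes f N -> vanishes g N -> vanishes (fun x => f x + g x) N.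
Proof.
move=> oU U0 sf sg vf vg s sN.
by rewrite (partials_add _ oU)// vf// vg// addr0.
Qed.

Lemma vanishesB U f g N : open U -> U 0 -> smooth_on U f -> smooth_on U g ->
  vanishes f N -> vanishes g N -> vanishes (fun x => f x - g x) N.
Proof.
move=> oU U0 sf sg vf vg s sN.
by rewrite (partials_sub _ oU)// vf// vg// subr0.
Qed.

Lemma vanishes_zero N : vanishes (fun=> 0) N.
Proof.
move=> s _; have -> : (fun=> 0) = mpolyfun (0 : mpoly n R).
  by apply/funext => x; rewrite /mpolyfun meval0.
rewrite partials_mpolyfun.
have -> : foldr (@mderiv n R) 0 s = 0 by elim: s => //= j s ->; exact: mderiv0.
by rewrite /mpolyfun meval0.
Qed.

Lemma vanishes_sum U T (r : seq T) (P : pred T) (F : T -> 'rV[R]_n -> R) N :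
  open U -> U 0 -> (forall i, P i -> smooth_on U (F i)) ->
  (forall i, P i -> vanishes (F i) N) ->
  vanishes (fun x => \sum_(i <- r | P i) F i x) N.
Proof.
move=> oU U0 sF vF; elim: r => [|i r IH].
  by apply: (eq_vanishes openT I _ (@vanishes_zero N)) => x _; rewrite big_nil.
have [Pi|Pi] := boolP (P i).
  apply: (eq_vanishes openT I _ (vanishesD oU U0 (sF _ Pi) _ (vF _ Pi) IH)) => [x _|].
    by rewrite big_cons Pi.
  exact: smooth_on_sum.
by apply: (eq_vanishes openT I _ IH) => x _; rewrite big_cons (negbTE Pi).
Qed.

(** By the Leibniz rule a derivative in direction j costs one of the factors at most w_j. The
    inequality N <= p + q, rather than an equality, survives truncated subtraction in the
    induction. *)
Lemma vanishesM U f g p q N : open U -> U 0 -> smooth_on U f -> smooth_on U g ->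
  (N <= p + q)%N -> vanishes f p -> vanishes g q ->
  vanishes (fun x => f x * g x) N.
Proof.
move=> oU U0; elim/ltn_ind: N f g p q => N IH f g p q sf sg Npq vf vg.
apply: vanishes_intro => [N0|j].
  have [p0|p0] := posnP p; last by rewrite (vanishes_at0 p0 vf) mul0r.
  have q0 : (0 < q)%N by lia.
  by rewrite (vanishes_at0 q0 vg) mulr0.
have [N0|N0] := posnP N; first by rewrite N0.
have lt : (N - w j < N)%N by have := w_gt0 j; lia.
apply: (eq_vanishes (f := fun x => partial j f x * g x + f x * partial j g x) oU U0).
  by move=> x Ux; rewrite (partialM _ sf sg).
have sfj := smooth_on_partial j sf; have sgj := smooth_on_partial j sg.
apply: (vanishesD oU U0); [exact: smooth_onM..| |].
- apply: (IH _ lt _ _ (p - w j)%N q) => //; first by lia.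
  exact: vanishes_partial.
- apply: (IH _ lt _ _ p (q - w j)%N) => //; first by lia.
  exact: vanishes_partial.
Qed.

(* The ball of radius r of the pseudo-norm max_j |x_j|^(1/w_j). *)
Definition box (r : R) : set 'rV[R]_n := [set x | forall j, `|x 0 j| <= r ^+ w j].

Lemma box_scale (r t : R) x : 0 <= t <= 1 -> box r x -> box r (t *: x).
Proof.
move=> /andP[t0 t1] bx j; rewrite mxE normrM ger0_norm//.
by apply: le_trans (bx j); rewrite ler_piMl.
Qed.

Lemma near_box (A : set 'rV[R]_n) : nbhs (0 : 'rV[R]_n) A ->
  \forall r \near (0 : R), 0 <= r -> forall x, box r x -> A x.
Proof.
move=> /nbhs_normP[d /= d0 dA].
apply/(@nbhs_normP _ R (0 : R)).
(* For r <= 1 one has r ^+ w j <= r, so the box of radius r lies in the closed sup-norm ball of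
   radius r. *)
exists (Num.min 1 (d / 2)) => /=; first by rewrite lt_min ltr01 divr_gt0.
move=> r; rewrite /ball_ /= sub0r normrN lt_min => /andP[r1 rd] r0 x bx.
apply: dA; rewrite /ball_ /= sub0r normrN.
rewrite ger0_norm// in r1 rd.
apply: (@le_lt_trans _ _ r); last by lra.
apply: row_norm_le => // j; apply: le_trans (bx j) _.
by apply: ler_iXnr => //; exact: ltW.
Qed.

(** For m > 0, f(x) = sum_j x_j d_j f(t x) for some t in [0, 1], where |x_j| <= r^(w_j) and, by
    induction, d_j f = O(r^(m - w_j)) on the box. For m = 0 this is local boundedness. *)
Lemma vanishes_box U f m : open U -> U 0 -> smooth_on U f -> vanishes f m ->
  exists2 C : R, 0 <= C &
    \forall r \near (0 : R), 0 <= r -> forall x, box r x -> `|f x| <= C * r ^+ m.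
Proof.
move=> oU U0; elim/ltn_ind: m f => m IH f sf vf.
have [m0|m0] := posnP m.
  exists (`|f 0| + 1); first by rewrite addr_ge0.
  rewrite m0; have : \forall x \near (0 : 'rV[R]_n), `|f 0 - f x| <= 1.
    exact: ((cvgrPdist_le _ _).1 (smooth_on_continuous sf U0)).
  move=> /near_box; apply: filterS => r h r0 x /(h r0) fx.
  rewrite expr0 mulr1 -[f x](subrK (f 0)) addrC.
  by apply: le_trans (ler_normD _ _) _; rewrite lerD// distrC.
have h j : exists C : R, 0 <= C /\ \forall r \near (0 : R), 0 <= r ->
    forall x, box r x -> `|partial j f x| <= C * r ^+ (m - w j).
  have lt : (m - w j < m)%N by have := w_gt0 j; lia.
  have [C C0 HC] := IH _ lt _ (smooth_on_partial j sf) (vanishes_partial vf).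
  by exists C.
have [C HC] := choice h.
exists (\sum_j C j); first by apply: sumr_ge0 => j _; exact: (HC j).1.
have nU : nbhs (0 : 'rV[R]_n) U by exact: (open_nbhs_nbhs (conj oU U0)).
have hall : \forall r \near (0 : R), forall j, 0 <= r ->
    forall x, box r x -> `|partial j f x| <= C j * r ^+ (m - w j).
  by apply: (@filter_forall _ _ _ (nbhs (0 : R)) _) => j; exact: (HC j).2.
have h1 : \forall r \near (0 : R), `|0 - r| <= 1.
  exact: ((cvgrPdist_le _ _).1 (@cvg_id _ (nbhs (0 : R)))).
apply: filterS3 (near_box nU) hall h1 => r rU rf r1 r0 x bx.
rewrite sub0r normrN ger0_norm// in r1.
have D (t : R) : 0 <= t <= 1 -> is_derive (0 + t *: x) x f
    (\sum_i x 0 i * partial i f (t *: x)).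
  move=> t01; rewrite add0r; apply: (is_derive_smooth x oU sf).
  by apply: rU => //; exact: box_scale.
have [t t01] := mvt_line (fun t t01 => @ex_derive _ _ _ _ _ _ _ (D t t01)).
rewrite (@derive_val _ _ _ _ _ _ _ (D t t01)) add0r (vanishes_at0 m0 vf) subr0 => ->.
apply: le_trans (ler_norm_sum _ _ _) _; rewrite mulr_suml; apply: ler_sum => j _.
rewrite normrM; apply: (@le_trans _ _ (r ^+ w j * (C j * r ^+ (m - w j)))).
  by apply: ler_pM => //; apply: rf => //; exact: box_scale.
rewrite mulrCA -exprD ler_wpM2l ?(HC j).1//.
(* The exponent w_j + (m - w_j) exceeds m when w_j > m; the bound r <= 1 absorbs the excess. *)
by apply: ler_wiXn2l => //; lia.
Qed.

End WeightedVanishing.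

(** * Comparing a pseudo-norm with the weighted boxes *)

Section PseudoNorm.
Variables (R : realType) (n : nat) (w : 'I_n -> nat).
Hypothesis w_gt0 : forall j, (0 < w j)%N.
Variable N : 'rV[R]_n -> R.
Hypothesis N_pseudo : pseudo_norm w N.
Implicit Types (f g : 'rV[R]_n -> R) (U : set 'rV[R]_n) (x : 'rV[R]_n).

Lemma dilation0r t : dilation w t 0 = 0 :> 'rV[R]_n.
Proof. by apply/rowP => j; rewrite !mxE mulr0. Qed.

Lemma dilation0l x : dilation w 0 x = 0.
Proof. by apply/rowP => j; rewrite !mxE expr0n eqn0Ngt w_gt0 mul0r. Qed.

Lemma pseudo_norm0 : N 0 = 0.
Proof.
by case: N_pseudo => _ _ _ NZ; rewrite -(dilation0r 0) NZ normr0 mul0r.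
Qed.

Lemma dilation_continuous x : continuous (fun t : R => dilation w t x).
Proof.
have -> : (fun t : R => dilation w t x) =
    (fun t : R => \sum_j (t ^+ w j * x 0 j) *: delta_mx 0 j).
  apply/funext => t; rewrite {1}[dilation w t x]row_sum_delta.
  by apply: eq_bigr => j _; rewrite mxE.
apply: continuous_big => [|j _ t]; first exact: add_continuous.
apply: (@continuousZr_tmp _ _ _ (fun t : R => t ^+ w j * x 0 j) (delta_mx 0 j) t).
apply: (@continuousM _ _ (fun t : R => t ^+ w j) (cst (x 0 j))).
  exact: exprn_continuous.
exact: cst_continuous.
Qed.

(** Take for nu the minimum of N on the compact unit sphere. If |x| > 1, some dilate t.x with 0 <= t
    <= 1 lies on the sphere, so N x >= t N x = N (t.x) >= nu. *)
Lemma pseudo_norm_ball : exists2 nu : R, 0 < nu & forall x, N x < nu -> `|x| <= 1.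
Proof.
have [Nc N0 Npos NZ] := N_pseudo.
pose S := [set x : 'rV[R]_n | `|x| = 1].
have [nu nu0 nuS] : exists2 nu : R, 0 < nu & forall x, S x -> nu <= N x.
  (* The sphere is empty when n = 0; any positive nu then serves. *)
  have [[x0 Sx0]|S0] := pselect (S !=set0); last first.
    by exists 1 => // x Sx; case: S0; exists x.
  have cS : compact S.
    apply: bounded_closed_compact.
      exists 1; split => // M M1 x; rewrite /S /= => ->; exact: ltW.
    have -> : S = (fun x : 'rV[R]_n => `|x|) @^-1` [set 1 : R] by [].
    apply: preimage_closed; last exact: closed_eq.
    by move=> x _; exact: norm_continuous.
  have [c /set_mem Sc cmin] : exists2 c, c \in S & forall x, x \in S -> N c <= N x.
    apply: EVT_min_rV => //; first by exists x0.
    exact: continuous_subspaceT.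
  exists (N c); last by move=> x Sx; apply: cmin; exact: mem_set.
  apply: Npos; apply/eqP => c0; move: Sc; rewrite /S /= c0 normr0 => /esym/eqP.
  by rewrite oner_eq0.
exists nu => // x xnu; rewrite leNgt; apply/negP => x1.
pose h (t : R) := `|dilation w t x|.
have ch : {within `[(0 : R), (1 : R)], continuous h}.
  apply: continuous_subspaceT => t.
  apply: continuous_comp; first exact: dilation_continuous.
  exact: norm_continuous.
have h0 : h 0 = 0 by rewrite /h dilation0l normr0.
have h1 : h 1 = `|x|.
  by rewrite /h; congr (`|_|); apply/rowP => j; rewrite mxE expr1n mul1r.
have [|t] := @IVT R h 0 1 1 ler01 ch.
  rewrite h0 h1 (min_l (normr_ge0 _)) (max_r (normr_ge0 _)) ler01.
  exact: ltW.
rewrite in_itv /= => /andP[t0 t1] ht.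
have := nuS _ ht; rewrite NZ ger0_norm// leNgt => /negP; apply.
by apply: le_lt_trans xnu; rewrite ler_piMl.
Qed.

(** Dilating a nonzero x by t = nu / (2 N x) brings its pseudo-norm below nu, hence its coordinates
    into [-1, 1]; dilating back gives |x_j| <= (1/t)^(w_j), and 1/t = (2/nu) N x. *)
Lemma pseudo_norm_box : exists2 c : R, 0 < c & forall x, box w (c * N x) x.
Proof.
have [Nc N0 Npos NZ] := N_pseudo.
have [nu nu0 nuP] := pseudo_norm_ball.
exists (2 / nu); first by rewrite divr_gt0.
move=> x j; have [->|/Npos Nx] := eqVneq x 0.
  by rewrite mxE normr0 exprn_ge0// mulr_ge0// divr_ge0// ltW.
pose t := nu / (2 * N x); have t0 : 0 < t by rewrite divr_gt0// mulr_gt0.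
have /nuP : N (dilation w t x) < nu.
  rewrite NZ gtr0_norm// /t.
  have -> : nu / (2 * N x) * N x = nu / 2 by field; rewrite gt_eqF.
  by rewrite gtr_pMr//; lra.
move=> /(le_trans (coord_le_row_norm _ j)); rewrite mxE normrM normrX gtr0_norm//.
have -> : 2 / nu * N x = t^-1 by rewrite /t; field; rewrite !gt_eqF.
by rewrite exprVn -[(_ ^+ _)^-1]mul1r ler_pdivlMr ?exprn_gt0// mulrC.
Qed.

Lemma vanishes_pseudo_norm U f m : open U -> U 0 -> smooth_on U f ->
  vanishes w f m ->
  exists2 C : R, 0 < C & \forall x \near (0 : 'rV[R]_n), `|f x| <= C * N x ^+ m.
Proof.
move=> oU U0 sf vf; have [Nc N0 Npos NZ] := N_pseudo.
have [C C0 HC] := vanishes_box w_gt0 oU U0 sf vf.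
have [c c0 cb] := pseudo_norm_box.
(* The added 1 makes the constant strictly positive, as the big-O criterion [eqO_exP] requires. *)
exists (C * c ^+ m + 1); first by rewrite ltr_wpDl// mulr_ge0// exprn_ge0// ltW.
have cN : (fun x => c * N x) @ (0 : 'rV[R]_n) --> (0 : R).
  have := @continuousM _ _ (cst c) N 0 (@cst_continuous _ _ _ _) (Nc 0).
  by rewrite /prop_for /continuous_at /= pseudo_norm0 mulr0.
have nC : \forall x \near (0 : 'rV[R]_n), 0 <= c * N x ->
    forall y, box w (c * N x) y -> `|f y| <= C * (c * N x) ^+ m := cN _ HC.
apply: filterS nC => x h.
have := h _ x (cb x); rewrite exprMn mulrA => {}h.
apply: le_trans (h _) _; first by rewrite mulr_ge0// ltW.
by rewrite ler_wpM2r ?exprn_ge0// lerDl.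
Qed.

End PseudoNorm.

(** * Weighted homogeneous Taylor polynomials *)

Section WeightedTaylor.
Variables (R : realType) (n : nat) (w : 'I_n -> nat).
Hypothesis w_gt0 : forall j, (0 < w j)%N.
Implicit Types (f g : 'rV[R]_n -> R) (U : set 'rV[R]_n) (x : 'rV[R]_n).
Implicit Types (p : mpoly n R).

Definition mnm_weight (a : multinom n) := (\sum_i a i * w i)%N.

Definition whomog (m : nat) p := forall a, a \in msupp p -> mnm_weight a = m.

Lemma mnm_weight_word s : mnm_weight (mnm_of_word s) = word_weight w s.
Proof.
rewrite /mnm_weight /word_weight; elim: s => [|j s IH].
  by rewrite big_nil big1// => i _; rewrite mnmE.
rewrite big_cons -IH [in RHS](bigD1 j)//= addnA [in LHS](bigD1 j)//=.
congr (_ + _)%N; first by rewrite !mnmE /= eqxx mulnDl mul1n.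
by apply: eq_bigr => i ij; rewrite !mnmE /= eq_sym (negbTE ij).
Qed.

Lemma mdeg_le_weight a : (mdeg a <= mnm_weight a)%N.
Proof.
by rewrite mdegE; apply: leq_sum => i _; rewrite -{1}[a i]muln1 leq_mul2l w_gt0 orbT.
Qed.

Lemma mnm_weight1 j : mnm_weight (mnm1 j) = w j.
Proof.
rewrite /mnm_weight (bigD1 j)//= mnm1E eqxx mul1n big1 ?addn0// => i ij.
by rewrite mnm1E eq_sym (negbTE ij).
Qed.

Lemma whomog_dilation m p t x : whomog m p ->
  mpolyfun p (dilation w t x) = t ^+ m * mpolyfun p x.
Proof.
move=> hp; rewrite /mpolyfun !mevalE mulr_sumr; apply: eq_big_seq => a /hp <-.
rewrite mulrCA; congr (_ * _).
rewrite /mnm_weight expr_sum -big_split /=; apply: eq_bigr => i _.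
by rewrite mxE exprMn -exprM mulnC.
Qed.

Definition taylor_coef f (a : multinom n) : R :=
  partials (word_of_mnm a) f 0 / (\prod_i (a i)`!)%:R.

(** Only the layer of weight m is kept, which is the leading part of a function vanishing to order
    m. As the weights are positive, monomials of weight m have degree at most m, so
    [bmultinom n m.+1] contains them all. *)
Definition wtaylor f m : mpoly n R :=
  \sum_(a : bmultinom n m.+1 | mnm_weight a == m) taylor_coef f a *: mpolyX R a.

Lemma mcoeff_wtaylor f m a :
  mcoeff a (wtaylor f m) = if mnm_weight a == m then taylor_coef f a else 0.
Proof.
rewrite /wtaylor raddf_sum /=; case: ifPn => [am|am].
  have lt : (mdeg a < m.+1)%N by rewrite ltnS -(eqP am) mdeg_le_weight.
  rewrite (bigD1 (Sub a lt : bmultinom n m.+1)) //= mcoeffZ mcoeffX eqxx mulr1.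
  rewrite big1 ?addr0// => b /andP[_ bs]; rewrite mcoeffZ mcoeffX.
  case: eqP => [ba|]; last by rewrite mulr0.
  by case/eqP: bs; apply: val_inj; rewrite /= ba.
rewrite big1// => b bm; rewrite mcoeffZ mcoeffX.
by case: eqP => [ba|]; [by rewrite -ba bm in am|rewrite mulr0].
Qed.

Lemma wtaylor_whomog f m : whomog m (wtaylor f m).
Proof.
by move=> a; rewrite mcoeff_msupp mcoeff_wtaylor; case: ifP => [/eqP//|_]; rewrite eqxx.
Qed.

Lemma mpolyfun_smooth_on U p : smooth_on U (mpolyfun p).
Proof. by apply: sub_smooth_on (mpolyfun_smooth p). Qed.

(** Derivatives at 0 of weight < m vanish for f by assumption and for the polynomial by homogeneity.
    Those of weight m extract from the polynomial one coefficient times a factorial, which is the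
    derivative of f. *)
Lemma vanishes_wtaylor U f m : open U -> U 0 -> smooth_on U f -> vanishes w f m ->
  vanishes w (fun x => f x - mpolyfun (wtaylor f m) x) m.+1.
Proof.
move=> oU U0 sf vf s; rewrite ltnS => sm.
rewrite (partials_sub _ oU sf (mpolyfun_smooth_on _) U0).
rewrite partials_mpolyfun foldr_mderiv mpolyfun0 mcoeff_mderivm.
have -> : mnm_add (mnm_of_word s) mnm0 = mnm_of_word s.
  by apply/mnmP => i; rewrite mnmDE mnm0E addn0.
rewrite mcoeff_wtaylor mnm_weight_word; case: eqP => [_|/eqP ms]; last first.
  by rewrite mul0rn subr0; apply: vf; rewrite ltn_neqAle ms.
under eq_bigr do rewrite ffactnn.
rewrite /taylor_coef -[X in _ - X]mulr_natr divfK.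
  by rewrite (partials_perm oU sf U0 (perm_word_of_mnm s)) subrr.
by rewrite pnatr_eq0 -lt0n prodn_gt0// => i; exact: fact_gt0.
Qed.

Lemma box_dilation x (r t : R) : 0 <= t -> box w r x -> box w (t * r) (dilation w t x).
Proof.
move=> t0 bx j; rewrite mxE normrM normrX ger0_norm// exprMn.
by rewrite ler_wpM2l ?exprn_ge0.
Qed.

Lemma box_norm x : box w (1 + `|x|) x.
Proof.
move=> j; apply: le_trans (coord_le_row_norm x j) _.
have : 1 + `|x| <= (1 + `|x|) ^+ w j by apply: ler_eXnr; rewrite ?lerDl.
by apply: le_trans; rewrite lerDr.
Qed.

(* If the order of vanishing were k < m, then the k-th weighted Taylor
   polynomial p would satisfy t^k p(x) = p(t.x) = O(t^(k+1)), so p = 0. *)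
Lemma vanishes_radial U f m : open U -> U 0 -> smooth_on U f ->
  (forall x, exists C : R, \forall t \near (0 : R), 0 < t ->
     `|f (dilation w t x)| <= C * t ^+ m) ->
  vanishes w f m.
Proof.
move=> oU U0 sf hf.
suff h k : (k <= m)%N -> vanishes w f k by exact: h.
elim: k => // k IH km; have vf := IH (ltnW km).
pose p := wtaylor f k.
have vp := vanishes_wtaylor oU U0 sf vf.
have sp : smooth_on U (fun x => f x - mpolyfun p x).
  exact: smooth_onB oU sf (mpolyfun_smooth_on _).
have [C C0 HC] := vanishes_box w_gt0 oU U0 sp vp.
suff p0 x : mpolyfun p x = 0.
  apply: (eq_vanishes oU U0 _ vp) => x _ /=.
  by rewrite -/p p0 subr0.
have [C1 H1] := hf x.
(* Since rho >= 1, its powers dominate it, so x lies in the box of radius rho and t.x in that of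
   radius t rho. *)
pose rho := 1 + `|x|; have rho0 : 0 <= rho by rewrite addr_ge0.
have cr : (fun t : R => t * rho) @ (0 : R) --> (0 : R).
  have := @continuousM R R id (cst rho) 0 (fun A => id) (@cst_continuous _ _ _ _).
  by rewrite /prop_for /continuous_at /= mul0r.
have H2 : \forall t \near (0 : R), 0 <= t * rho -> forall y, box w (t * rho) y ->
    `|f y - mpolyfun p y| <= C * (t * rho) ^+ k.+1 := cr _ HC.
(* After division by t^k, the first term bounds the contribution of f(t.x), using m >= k + 1 and t
   <= 1, and the second that of f - p at t.x. *)
pose K := `|C1| + C * rho ^+ k.+1.
have K0 : 0 <= K by rewrite addr_ge0// mulr_ge0// exprn_ge0.
have H3 : \forall t \near (0 : R), 0 < t -> t <= 1 -> `|mpolyfun p x| <= K * t.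
  apply: filterS2 H1 H2 => t h1 h2 t0 t1.
  have {}h1 := h1 t0.
  have {}h2 := h2 (mulr_ge0 (ltW t0) rho0) _ (box_dilation (ltW t0) (@box_norm x)).
  rewrite -(ler_pM2l (exprn_gt0 k t0)) mulrCA -exprSr.
  have -> : t ^+ k * `|mpolyfun p x| = `|mpolyfun p (dilation w t x)|.
    rewrite (whomog_dilation _ _ (@wtaylor_whomog f k)) normrM.
    by rewrite (@ger0_norm _ (t ^+ k))// exprn_ge0// ltW.
  rewrite -(subKr (f (dilation w t x)) (mpolyfun p _)).
  apply: le_trans (ler_normB _ _) _; rewrite /K mulrDl; apply: lerD.
    apply: le_trans h1 _; apply: le_trans (ler_norm _) _.
    rewrite normrM ler_wpM2l// normrX gtr0_norm//.
    by apply: ler_wiXn2l => //; exact: ltW.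
  by apply: le_trans h2 _; rewrite exprMn -mulrA [_ * rho ^+ _]mulrC.
apply/eqP; rewrite -normr_le0; apply/ler_addgt0Pr => e e0; rewrite add0r.
have /nbhs_normP[d /= d0 dP] := H3.
(* Small enough for [H3] to apply and for K t <= e; [K + 1] avoids dividing by zero. *)
pose t := Num.min (Num.min 1 (d / 2)) (e / (K + 1)).
have K1 : 0 < K + 1 by rewrite ltr_wpDl.
have t0 : 0 < t by rewrite /t !lt_min ltr01 !divr_gt0.
have t1 : t <= 1 by rewrite /t !ge_min lexx.
have td : t <= d / 2 by rewrite /t !ge_min lexx orbT.
have te : t <= e / (K + 1) by rewrite /t ge_min lexx orbT.
apply: le_trans (dP t _ t0 t1) _.
  by rewrite /ball_ /= sub0r normrN gtr0_norm//; lra.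
apply: (@le_trans _ _ ((K + 1) * t)); first by rewrite ler_pM2r// lerDl.
by rewrite -ler_pdivlMl// mulrC.
Qed.

End WeightedTaylor.

(** * The homogeneous part of a coordinate change *)

Section HomogeneousPart.
Variables (R : realType) (n : nat) (w : 'I_n -> nat).
Hypothesis w_gt0 : forall j, (0 < w j)%N.
Implicit Types (U : set 'rV[R]_n) (x y : 'rV[R]_n) (p : 'I_n -> mpoly n R).

Lemma jacobian_partial (F : 'rV[R]_n -> 'rV[R]_n) x j k : differentiable F x ->
  ('J F x) j k = partial j (fun y => F y 0 k) x.
Proof. by move=> dF; rewrite /jacobian mxE diff_row. Qed.

Definition mpolymap p x : 'rV[R]_n := \row_k mpolyfun (p k) x.

Lemma mpolymap_smooth p : smooth_map_on setT (mpolymap p).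
Proof.
move=> k; apply: (eq_smooth_on openT _ (mpolyfun_smooth (p k))) => x _.
by rewrite mxE.
Qed.

(** Homogeneity already kills the coefficient of x_j in p_k when w_j differs from w_k, so the second
    clause makes the whole linear part the identity. *)
Definition unipotent p := (forall k, whomog w (w k) (p k)) /\
  forall j k, w j = w k -> mcoeff (mnm1 j) (p k) = (j == k)%:R.

Definition nonlinear_part p k := p k - mpolyX R (mnm1 k).

Lemma mpolymapE p x :
  mpolymap p x = x + mpolymap (nonlinear_part p) x.
Proof.
apply/rowP => k; rewrite !mxE /mpolyfun mevalB mevalXU addrC subrK.
by [].
Qed.

(* A monomial of weight w_k containing a variable x_i with w_i >= w_k is x_i
   itself, and the linear part of p_k is x_k. *)
Lemma nonlinear_part_weight p k a i : unipotent p ->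
  a \in msupp (nonlinear_part p k) -> a i != 0%N -> (w i < w k)%N.
Proof.
move=> [hp lp]; rewrite mcoeff_msupp /nonlinear_part mcoeffB mcoeffX => ak ai.
rewrite ltnNge; apply/negP => wki.
have ne : a != mnm1 k.
  by apply: contraNneq ak => ->; rewrite eqxx lp// eqxx subrr.
move: ak; rewrite [mnm1 k == a]eq_sym (negbTE ne) subr0 => ak.
have := hp k a; rewrite mcoeff_msupp ak => /(_ isT) wa.
have e : (\sum_(l | l != i) a l * w l = w k - a i * w i)%N.
  by rewrite -wa /mnm_weight [in RHS](bigD1 i)//= addKn.
have le : (a i * w i <= w k)%N.
  by rewrite -wa /mnm_weight (bigD1 i)//= leq_addr.
have wi := w_gt0 i.
(* From a_i w_i <= w_k <= w_i with a_i and w_i positive; no weight remains for the other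
   variables. *)
have ai1 : a i = 1%N by nia.
have wik : w i = w k by nia.
have z l : l != i -> a l = 0%N.
  move=> li; have : (\sum_(l | l != i) a l * w l = 0)%N by rewrite e ai1 wik mul1n subnn.
  move=> /eqP; rewrite sum_nat_eq0 => /forallP /(_ l) /implyP /(_ li).
  by rewrite muln_eq0 (gtn_eqF (w_gt0 l)) orbF => /eqP.
have ae : a = mnm1 i.
  apply/mnmP => l; rewrite mnm1E eq_sym; have [->//|/z ->] := eqVneq l i.
  by [].
move: ak ne; rewrite ae lp//.
by have [->|_] := eqVneq i k; rewrite eqxx.
Qed.

Lemma nonlinear_part_dep p k x y : unipotent p ->
  (forall j, (w j < w k)%N -> x 0 j = y 0 j) ->
  mpolyfun (nonlinear_part p k) x = mpolyfun (nonlinear_part p k) y.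
Proof.
move=> up xy; rewrite /mpolyfun !mevalE; apply: eq_big_seq => a ak.
congr (_ * _); apply: eq_bigr => i _.
have [->|ai] := eqVneq (a i) 0%N; first by rewrite !expr0.
by rewrite xy//; exact: nonlinear_part_weight ak ai.
Qed.

(** Induction on the weight: once the coordinates of weight < w_k agree, so do the nonlinear parts
    of component k, and they cancel. *)
Lemma unipotent_inj p : unipotent p -> injective (mpolymap p).
Proof.
move=> up x y xy.
suff h i k : (w k <= i)%N -> x 0 k = y 0 k by apply/rowP => k; exact: (h (w k)).
elim: i k => [|i IH] k wk; first by have := w_gt0 k; lia.
have := congr1 (fun z : 'rV[R]_n => z 0 k) xy; rewrite /= (mpolymapE p x) (mpolymapE p y) !mxE.
rewrite (@nonlinear_part_dep _ _ x y)//; first exact: addIr.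
by move=> j jk; apply: IH; lia.
Qed.

(* The inverse solves x = y - q(x), q the nonlinear part; as q_k only involves
   variables of weight < w_k, the iteration is stationary. *)
Fixpoint unipotent_inv_iter p i y : 'rV[R]_n :=
  if i is i'.+1 then y - mpolymap (nonlinear_part p) (unipotent_inv_iter p i' y)
  else 0.

Lemma unipotent_inv_iter_smooth p i : smooth_map_on setT (unipotent_inv_iter p i).
Proof.
elim: i => [|i IH] k.
  apply: (eq_smooth_on openT _ (smooth_on_cst 0 openT)) => y _.
  by rewrite mxE.
have sx : smooth_on setT (fun y : 'rV[R]_n => y 0 k).
  by rewrite -mpolyfunX; exact: mpolyfun_smooth.
have sq := smooth_on_comp openT openT (mpolyfun_smooth (nonlinear_part p k)) IH (fun _ _ => I).
apply: (eq_smooth_on openT _ (smooth_onB openT sx sq)) => y _.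
by rewrite !mxE.
Qed.

Lemma unipotent_inv_iter_stable p i y k : unipotent p -> (w k <= i)%N ->
  unipotent_inv_iter p i.+1 y 0 k = unipotent_inv_iter p i y 0 k.
Proof.
move=> up; elim: i k => [|i IH] k wk; first by have := w_gt0 k; lia.
rewrite [LHS]/= [RHS]/= !mxE; congr (_ - _); apply: nonlinear_part_dep => // j jk.
by apply: IH; lia.
Qed.

(** After as many iterations as the largest weight every coordinate is stationary, which gives a
    right inverse; injectivity makes it two-sided. *)
Lemma unipotent_diffeomorphism p : unipotent p -> diffeomorphism (mpolymap p).
Proof.
move=> up; split; first exact: mpolymap_smooth.
pose W := \max_j w j; pose G := unipotent_inv_iter p W.
have GK : cancel G (mpolymap p).
  move=> y; rewrite (mpolymapE p).
  have {1}-> : G y = y - mpolymap (nonlinear_part p) (G y).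
    apply/rowP => k; rewrite /G -unipotent_inv_iter_stable//.
    exact: leq_bigmax.
  by rewrite subrK.
exists G; split => //; first exact: unipotent_inv_iter_smooth.
by move=> x; apply: (unipotent_inj up); rewrite GK.
Qed.

Lemma mpolymap_homogeneous p : (forall k, whomog w (w k) (p k)) ->
  w_homogeneous w (mpolymap p).
Proof.
by move=> hp t x; apply/rowP => k; rewrite !mxE; exact: whomog_dilation.
Qed.

Variable N : 'rV[R]_n -> R.
Hypothesis N_pseudo : pseudo_norm w N.
Variables (U : set 'rV[R]_n) (phi : 'rV[R]_n -> 'rV[R]_n).
Hypotheses (oU : open U) (U0 : U 0) (phi_smooth : smooth_map_on U phi).

Lemma vanishes_homogeneous_part :
  (forall j k, partial j (fun y => phi y 0 k) 0 = (j == k)%:R) ->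
  (forall k, vanishes w (fun y => phi y 0 k) (w k)) ->
  exists phihat, [/\ polynomial_map phihat, w_homogeneous w phihat,
    diffeomorphism phihat, 'J phihat 0 = 1%:M &
    bigO_w w N 1 (fun y => phi y - phihat y)].
Proof.
move=> dphi vphi; pose p k := wtaylor w (fun y => phi y 0 k) (w k).
have hp k : whomog w (w k) (p k) by exact: wtaylor_whomog.
have vp k : vanishes w (fun y => phi y 0 k - mpolyfun (p k) y) (w k).+1.
  exact: (vanishes_wtaylor w_gt0 oU U0).
have cp j k : mcoeff (mnm1 j) (p k) = partial j (mpolyfun (p k)) 0.
  rewrite partial_mpolyfun mpolyfun0 mcoeff_mderiv.
  have -> : mnm_add mnm0 (mnm1 j) = mnm1 j by apply/mnmP => i; rewrite mnmDE mnm0E.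
  by rewrite mnm0E.
(* When w_j = w_k, d_j has weight below w_k + 1, so phi_k and p_k have the same derivative along it
   at 0. *)
have lp j k : w j = w k -> mcoeff (mnm1 j) (p k) = (j == k)%:R.
  move=> wjk; rewrite cp; have := vp k [:: j].
  rewrite /word_weight big_seq1 wjk ltnSn => /(_ isT).
  rewrite (partials_sub _ oU (phi_smooth k) (mpolyfun_smooth_on _) U0) /=.
  by rewrite dphi => /eqP; rewrite subr_eq0 => /eqP.
have up : unipotent p by [].
exists (mpolymap p); split.
- by move=> k; exists (p k) => x; rewrite mxE.
- exact: mpolymap_homogeneous.
- exact: unipotent_diffeomorphism.
- apply/matrixP => j k; rewrite jacobian_partial; last first.
    exact: (smooth_map_differentiable openT (mpolymap_smooth p) I).
  have -> : (fun y => mpolymap p y 0 k) = mpolyfun (p k).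
    by apply/funext => y; rewrite mxE.
  rewrite -cp mxE; have [/lp //|wjk] := eqVneq (w j) (w k).
  have -> : (j == k) = false by apply: contra_neqF wjk => /eqP ->.
  apply/memN_msupp_eq0/negP => /hp; rewrite mnm_weight1 => /eqP.
  by rewrite (negbTE wjk).
- move=> k; have sk := smooth_onB oU (phi_smooth k) (@mpolyfun_smooth_on _ _ U (p k)).
  have [C C0 HC] := vanishes_pseudo_norm w_gt0 N_pseudo oU U0 sk (vp k).
  apply/eqO_exP; exists C; first exact: C0.
  apply: filterS HC => y; rewrite !mxE addn1 => h; apply: le_trans h _.
  by rewrite ler_wpM2l ?ler_norm// ltW.
Qed.

(** At t.x the k-th component of phihat is t^(w_k) phihat_k(x) and the error is O(t^(w_k + 1)), so
    phi_k is radially O(t^(w_k)) and [vanishes_radial] applies. *)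
Lemma bigO_w_vanishes (phihat : 'rV[R]_n -> 'rV[R]_n) : w_homogeneous w phihat ->
  bigO_w w N 1 (fun y => phi y - phihat y) ->
  forall k, vanishes w (fun y => phi y 0 k) (w k).
Proof.
move=> hhat bO k; apply: (vanishes_radial w_gt0 oU U0 (phi_smooth k)) => x.
have /eqO_exP [C [C0 HC]] := bO k.
have [_ N0 _ NZ] := N_pseudo.
exists (`|phihat x 0 k| + C * N x ^+ (w k).+1).
have dx : (fun t : R => dilation w t x) @ (0 : R) --> (0 : 'rV[R]_n).
  have := @dilation_continuous _ _ w x 0.
  by rewrite /continuous_at dilation0l.
have H2 : \forall t \near (0 : R), `|(phi (dilation w t x) - phihat (dilation w t x)) 0 k| <=
    C * `|N (dilation w t x) ^+ (w k + 1)| := dx _ HC.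
have h1 : \forall r \near (0 : R), `|0 - r| <= 1.
  exact: ((cvgrPdist_le _ _).1 (@cvg_id _ (nbhs (0 : R)))).
apply: filterS2 H2 h1 => t; rewrite hhat !mxE NZ addn1 sub0r normrN => h t1 t0.
rewrite gtr0_norm// in t1.
rewrite mulrDl -[phi _ 0 k](subrK (t ^+ w k * phihat x 0 k)) addrC.
apply: le_trans (ler_normD _ _) _; apply: lerD.
  by rewrite mulrC normrM normrX (gtr0_norm t0).
apply: le_trans h _; rewrite -mulrA; apply: ler_wpM2l; first exact: ltW.
rewrite (gtr0_norm t0) exprMn ger0_norm; last first.
  by rewrite mulr_ge0// exprn_ge0// ltW.
rewrite [leRHS]mulrC; apply: ler_wpM2r; first exact: exprn_ge0.
by apply: ler_wiXn2l => //; exact: ltW.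
Qed.

End HomogeneousPart.

(** * Frames in coordinates *)

Section ChartSmoothness.
Variables (R : realType) (n : nat) (M : topologicalType).
Implicit Types (c d : pre_chart R n M) (W : set M) (f : M -> R).

Lemma open_inP (S T : topologicalType) (D : set S) (h : S -> T) (O : set T) :
  open D -> {in D, continuous h} -> open O -> open (D `&` h @^-1` O).
Proof.
move=> oD ch oO; rewrite openE => p [Dp Op]; apply: filterI.
  exact: (open_nbhs_nbhs (conj oD Dp)).
by apply: (ch p (mem_set Dp)); exact: (open_nbhs_nbhs (conj oO Op)).
Qed.

Lemma open_chart_image c W : is_chart c -> open W ->
  open (chart_map c @` (chart_dom c `&` W)).
Proof.
move=> [oD oI cK cc ci] oW.
suff -> : chart_map c @` (chart_dom c `&` W) = chart_im c `&` chart_inv c @^-1` W.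
  exact: open_inP.
apply/seteqP; split=> [_ [p [Dp Wp] <-]|y [[p Dp <-]]].
  by split; [exists p|rewrite /= cK ?inE].
by rewrite /= cK ?inE// => Wp; exists p.
Qed.

(** On the overlap, f read in c is f read in d composed with the transition map from c to d. *)
Lemma smooth_change_coordinates c d W f : is_chart c -> is_chart d ->
  smooth_transition c d -> open W ->
  smooth_on (chart_map d @` (chart_dom d `&` W)) (f \o chart_inv d) ->
  smooth_on (chart_map c @` (chart_dom c `&` (chart_dom d `&` W)))
    (f \o chart_inv c).
Proof.
move=> hc hd tr oW sf; have [_ _ cK _ _] := hc; have [oD _ dK _ _] := hd.
have oO := open_chart_image hc (openI oD oW).
have st : smooth_map_on (chart_map c @` (chart_dom c `&` (chart_dom d `&` W)))
    (chart_map d \o chart_inv c).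
  move=> k; apply: sub_smooth_on (tr k); apply: image_subset.
  by move=> p [? [? ?]].
have sub y : (chart_map c @` (chart_dom c `&` (chart_dom d `&` W))) y ->
    (chart_map d @` (chart_dom d `&` W)) ((chart_map d \o chart_inv c) y).
  by move=> [p [Cp [Dp Wp]] <-]; rewrite /= cK ?inE//; exists p.
apply: (eq_smooth_on oO _ (smooth_on_comp oO (open_chart_image hd oW) sf st sub)).
by move=> _ [p [Cp [Dp Wp]] <-] /=; rewrite cK ?inE// dK ?inE.
Qed.

Variable A : smooth_manifold R n M.

(** Membership in the maximal atlas, that is, [centered_coordinates] without the base point. *)
Definition compatible c :=
  is_chart c /\ forall d, atlas A d -> smooth_transition c d /\ smooth_transition d c.

Lemma smooth_fun_chart c W f : compatible c -> open W -> smooth_fun A W f ->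
  smooth_on (chart_map c @` (chart_dom c `&` W)) (f \o chart_inv c).
Proof.
move=> [hc tr] oW sf s _ [p [Cp Wp] <-]; have [d Ad Dp] := atlas_cover A p.
apply: (smooth_change_coordinates hc (atlas_chart Ad) (tr d Ad).1 oW (sf d Ad)).
by exists p.
Qed.

Lemma chart_smooth_fun c W f : compatible c -> open W -> W `<=` chart_dom c ->
  smooth_on (chart_map c @` W) (f \o chart_inv c) -> smooth_fun A W f.
Proof.
move=> [hc tr] oW WC sf d Ad.
have -> : chart_dom d `&` W = chart_dom d `&` (chart_dom c `&` W).
  by congr (_ `&` _); apply/esym/setIidr.
apply: (smooth_change_coordinates (atlas_chart Ad) hc (tr d Ad).2 oW).
by rewrite (setIidr WC).
Qed.

Lemma sub_smooth_fun W W' f : W' `<=` W -> smooth_fun A W f -> smooth_fun A W' f.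
Proof.
move=> sub sf d Ad; apply: sub_smooth_on (sf d Ad); apply: image_subset.
by move=> p [? /sub].
Qed.

Lemma coordinate_smooth_fun c k : compatible c ->
  smooth_fun A (chart_dom c) (fun p => chart_map c p 0 k).
Proof.
move=> hc; have [[oD oI cK _ _] _] := hc.
apply: (chart_smooth_fun hc oD) => //.
apply: (eq_smooth_on oI _ (mpolyfun_smooth_on (mpolyX R (mnm1 k)))).
by move=> _ [p Cp <-]; rewrite mpolyfunX /= cK ?inE.
Qed.

Lemma coordinate_tangent c k p : compatible c -> chart_dom c p ->
  is_tangent A p (fun f => partial k (f \o chart_inv c) (chart_map c p)).
Proof.
move=> hc Cp f g [W [oW Wp sf]] [W' [oW' Wp' sg]].
have [[_ _ cK _ _] _] := hc.
pose O := chart_map c @` (chart_dom c `&` (W `&` W')).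
have oO : open O by exact: (open_chart_image hc.1 (openI oW oW')).
have Op : O (chart_map c p) by exists p.
have sfO : smooth_on O (f \o chart_inv c).
  apply: (smooth_fun_chart hc (openI oW oW')); apply: sub_smooth_fun sf.
  exact: subIsetl.
have sgO : smooth_on O (g \o chart_inv c).
  apply: (smooth_fun_chart hc (openI oW oW')); apply: sub_smooth_fun sg.
  exact: subIsetr.
split=> [a|].
  have sa := smooth_on_cst a oO; have saf := smooth_onM oO sa sfO.
  rewrite -[LHS]/(partial k (fun y => a * (f \o chart_inv c) y + (g \o chart_inv c) y) _).
  rewrite (partialD _ saf sgO)// (partialM _ sa sfO)//.
  by rewrite [X in X * _]derive_cst mul0r add0r.
rewrite -[LHS]/(partial k (fun y => (f \o chart_inv c) y * (g \o chart_inv c) y) _).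
by rewrite (partialM _ sfO sgO)//= cK ?inE.
Qed.

Lemma partial_coordinate j k (y : 'rV[R]_n) :
  partial j (fun z : 'rV[R]_n => z 0 k) y = (j == k)%:R.
Proof.
rewrite -mpolyfunX partial_mpolyfun mderivX mnm1E /mpolyfun mevalZ eq_sym.
have [->|_] := eqVneq j k; last by rewrite mul0r.
have -> : mnm_sub (mnm1 k) (mnm1 k) = mnm0 by apply/mnmP => i; rewrite mnmBE subnn mnm0E.
by rewrite mpolyX0 meval1 mulr1.
Qed.

Lemma partial_coordinate_chart c j k p : is_chart c -> chart_dom c p ->
  partial j ((fun q => chart_map c q 0 k) \o chart_inv c) (chart_map c p) = (j == k)%:R.
Proof.
move=> [_ oI cK _ _] Cp; rewrite -(partial_coordinate j k (chart_map c p)).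
apply: near_eq_derive; apply: near_open oI _ _; first by exists p.
by move=> _ [q Cq <-] /=; rewrite cK ?inE.
Qed.

(* A frame spans all derivations, in particular the coordinate ones; inverting
   that relation expresses the frame in coordinates. *)
Lemma frame_in_coordinates c V (X : 'I_n -> vfield R M) p f i : compatible c ->
  is_frame A (is_tangent A) V X -> V p -> chart_dom c p -> smooth_near A p f ->
  X i p f = \sum_k X i p (fun q => chart_map c q 0 k) *
              partial k (f \o chart_inv c) (chart_map c p).
Proof.
move=> hc [_ fr] Vp Cp sf; have [_ spanE] := fr p Vp.
have h k : exists C : 'I_n -> R, forall g, smooth_near A p g ->
    partial k (g \o chart_inv c) (chart_map c p) = \sum_i C i * X i p g.
  have := coordinate_tangent k hc Cp; rewrite spanE => -[C HC].
  by exists C.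
have [C HC] := choice h.
pose B : 'M[R]_n := \matrix_(i, k) X i p (fun q => chart_map c q 0 k).
pose Cm : 'M[R]_n := \matrix_(k, i) C k i.
have sx k : smooth_near A p (fun q => chart_map c q 0 k).
  exists (chart_dom c); split => //; first by case: hc.1.
  exact: coordinate_smooth_fun.
(* Expand d_k x_l = delta_kl in the frame. A one-sided inverse of a square matrix is two-sided, so
   the relation can be inverted. *)
have CB : Cm *m B = 1%:M.
  apply/matrixP => k l; rewrite !mxE -(partial_coordinate_chart k l hc.1 Cp).
  by rewrite (HC _ _ (sx l)); apply: eq_bigr => j _; rewrite !mxE.
have BC := mulmx1C CB.
under eq_bigr do rewrite HC// mulr_sumr.
rewrite exchange_big /= (eq_bigr (fun j => (B *m Cm) i j * X j p f)); last first.
  move=> j _; rewrite mxE mulr_suml; apply: eq_bigr => k _.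
  by rewrite !mxE mulrA.
rewrite BC (bigD1 i)//= mxE eqxx mul1r big1 ?addr0// => j ji.
by rewrite mxE eq_sym (negbTE ji) mul0r.
Qed.

End ChartSmoothness.

(** * Privileged coordinates *)

Section OrderInPrivilegedCoordinates.
Variables (R : realType) (n : nat) (M : topologicalType).
Variables (A : smooth_manifold R n M) (w : 'I_n -> nat).
Hypothesis w_gt0 : forall j, (0 < w j)%N.
Variables (a : M) (V : set M) (X : 'I_n -> vfield R M).
Hypotheses (oV : open V) (X_frame : is_frame A (is_tangent A) V X).
Variable x : pre_chart R n M.
Hypotheses (x_compat : compatible A x) (x_lin : linearly_adapted A X a x).
Hypotheses (Cxa : chart_dom x a) (xa0 : chart_map x a = 0).
Hypothesis x_order : forall k, order_ge w X a (fun p => chart_map x p 0 k) (w k).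
Variable W : set M.
Hypotheses (oW : open W) (Wa : W a) (WV : W `<=` V) (WC : W `<=` chart_dom x).
Implicit Types (f : M -> R).

Local Notation coord k := (fun p => chart_map x p 0 k).
Local Notation O := (chart_map x @` W).
Local Notation T f := (f \o chart_inv x).

Lemma word_action_rcons I j f :
  word_action X (rcons I j) f = word_action X I (fun p => X j p f).
Proof. exact: foldr_rcons. Qed.

Lemma order_ge_frame f N j : order_ge w X a f N ->
  order_ge w X a (fun p => X j p f) (N - w j).
Proof.
move=> of_ I IN; rewrite -word_action_rcons; apply: of_.
by rewrite word_weight_rcons; lia.
Qed.

Lemma order_ge_at f N : (0 < N)%N -> order_ge w X a f N -> f a = 0.
Proof. by move=> N0 of_; apply: (of_ [::]); rewrite /word_weight big_nil. Qed.

Lemma order_geW f m N : (m <= N)%N -> order_ge w X a f N -> order_ge w X a f m.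
Proof. by move=> mN of_ I Im; apply: of_; exact: leq_trans mN. Qed.

Lemma chart_inv0 : chart_inv x 0 = a.
Proof. by case: x_compat => -[_ _ xK _ _] _; rewrite -xa0 xK ?inE. Qed.

Let oO : open O.
Proof. by rewrite -[W](setIidr WC); exact: (open_chart_image x_compat.1). Qed.

Let O0 : O 0. Proof. by exists a. Qed.

Lemma smooth_fun_coordinates f : smooth_fun A W f -> smooth_on O (T f).
Proof.
by move=> sf; rewrite -[W](setIidr WC); exact: (smooth_fun_chart x_compat).
Qed.

Lemma smooth_coord k : smooth_fun A W (coord k).
Proof. exact: sub_smooth_fun WC (coordinate_smooth_fun k x_compat). Qed.

Lemma smooth_frame f j : smooth_fun A W f -> smooth_fun A W (fun p => X j p f).
Proof. by move=> sf; apply: (X_frame.1 j).2. Qed.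

Lemma smooth_fun_near f p : smooth_fun A W f -> W p -> smooth_near A p f.
Proof. by move=> sf Wp; exists W. Qed.

Lemma frame_coordinates f j y : smooth_fun A W f -> O y ->
  T (fun p => X j p f) y =
  \sum_k T (fun p => X j p (coord k)) y * partial k (T f) y.
Proof.
move=> sf [p Wp <-]; have [[_ _ xK _ _] _] := x_compat.
rewrite /= xK ?inE; last exact: WC.
exact: (frame_in_coordinates j x_compat X_frame (WV Wp) (WC Wp) (smooth_fun_near sf Wp)).
Qed.

Lemma frame_coefficient0 j k : T (fun p => X j p (coord k)) 0 = (j == k)%:R.
Proof.
rewrite /= chart_inv0 x_lin; last exact: smooth_fun_near (smooth_coord k) Wa.
by rewrite -xa0 partial_coordinate_chart//; exact: x_compat.1.
Qed.

(** With b_jk = X_j x_k, write d_j f = X_j f - sum_k (b_jk - delta_jk) d_k f and show that each term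
    has weighted order N - w_j. The term X_j f is covered by induction on N. *)
Lemma order_ge_vanishes f N : smooth_fun A W f -> order_ge w X a f N ->
  vanishes w (T f) N.
Proof.
elim/ltn_ind: N f => N IH f sf of_.
have [->|N0] := posnP N; first by [].
have sTf := smooth_fun_coordinates sf.
have sb j k : smooth_on O (T (fun p => X j p (coord k))).
  exact/smooth_fun_coordinates/smooth_frame/smooth_coord.
have sc j k : smooth_on O (fun y => T (fun p => X j p (coord k)) y - (j == k)%:R).
  exact: smooth_onB oO (sb j k) (smooth_on_cst _ oO).
have ltN : (N.-1 < N)%N by lia.
(* One order less than wanted; it serves for the directions k of weight <= w_j, which the downward
   induction has not reached. *)
have vf1 : vanishes w (T f) N.-1.
  by apply: IH => //; apply: order_geW of_; lia.
apply: vanishes_intro => [_|j]; first by rewrite /= chart_inv0; exact: order_ge_at of_.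
pose m := \max_i w i; have wm i : (w i <= m)%N by exact: leq_bigmax.
(* downward induction on the weight of the direction *)
move: {2}(m - w j).+1 (ltnSn (m - w j)) => e; elim: e j => // e IHe j.
rewrite ltnS => je.
pose F k y := (T (fun p => X j p (coord k)) y - (j == k)%:R) * partial k (T f) y.
apply: (eq_vanishes (f := fun y => T (fun p => X j p f) y - \sum_k F k y) oO O0).
  move=> y Oy; rewrite (frame_coordinates j sf Oy).
  rewrite -sumrB (eq_bigr (fun k => (j == k)%:R * partial k (T f) y)) => [|k _]; last first.
    by rewrite /F mulrBl subKr.
  rewrite (bigD1 j)//= eqxx mul1r big1 ?addr0// => k kj.
  by rewrite eq_sym (negbTE kj) mul0r.
have sX : smooth_on O (T (fun p => X j p f)).
  exact/smooth_fun_coordinates/smooth_frame.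
have sk k : smooth_on O (F k).
  exact: smooth_onM oO (sc j k) (smooth_on_partial k sTf).
have wj := w_gt0 j.
apply: (vanishesB oO O0 sX).
- exact: (@smooth_on_sum _ _ O _ _ predT F oO (fun k _ => sk k)).
- by apply: IH; [lia|exact: smooth_frame|exact: order_ge_frame].
apply: (@vanishes_sum _ _ w O _ _ predT F _ oO O0) => [k _|k _]; first exact: sk.
have sfk := smooth_on_partial k sTf.
(* If w_k <= w_j, the coefficient b_jk - delta_jk vanishes at 0, and this one order makes up for the
   one missing in [vf1]. *)
have [wkj|wjk] := leqP (w k) (w j).
  apply: (vanishesM w_gt0 oO O0 (sc j k) sfk (p := 1) (q := N.-1 - w k)); first by lia.
  - apply: vanishes_intro => [_|l]; first by rewrite frame_coefficient0 subrr.
    by have := w_gt0 l; case: (w l) => // l' _; rewrite subSS sub0n.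
  - exact: vanishes_partial.
have njk : (j == k) = false by apply/eqP => jk; rewrite jk ltnn in wjk.
(* The outer induction handles orders below N only, hence the minimum; N - 1 is enough since w_j >=
   1. The order of d_k f comes from the downward induction. *)
apply: (vanishesM w_gt0 oO O0 (sc j k) sfk (p := minn (w k - w j) N.-1) (q := N - w k)).
- by have := wm k; lia.
- apply: (eq_vanishes oO O0 (f := T (fun p => X j p (coord k)))).
    by move=> y _; rewrite njk subr0.
  apply: IH; [lia|exact/smooth_frame/smooth_coord|].
  apply: (order_geW (geq_minl _ _)); apply: order_ge_frame; exact: x_order.
- by apply: IHe; have := wm k; lia.
Qed.

(** In X_j f = sum_k b_jk d_k f, the coefficient has weighted order w_k - w_j by the previous lemma
    and d_k f has order N - w_k, so X_j f has order N - w_j and the induction on N proceeds. *)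
Lemma vanishes_order_ge f N : smooth_fun A W f -> vanishes w (T f) N ->
  order_ge w X a f N.
Proof.
elim/ltn_ind: N f => N IH f sf vf I.
case/lastP: I => [|I j].
  rewrite /word_weight big_nil => N0.
  by have := vanishes_at0 N0 vf; rewrite /= chart_inv0.
rewrite word_weight_rcons word_action_rcons => IN; have wj := w_gt0 j.
have lt : (N - w j < N)%N by lia.
apply: (IH _ lt); [exact: smooth_frame| |by rewrite ltn_subRL addnC].
pose F k y := T (fun p => X j p (coord k)) y * partial k (T f) y.
apply: (eq_vanishes (f := fun y => \sum_k F k y) oO O0).
  by move=> y Oy; rewrite (frame_coordinates j sf Oy).
have sb k : smooth_on O (T (fun p => X j p (coord k))).
  exact/smooth_fun_coordinates/smooth_frame/smooth_coord.
have sfk k := smooth_on_partial k (smooth_fun_coordinates sf).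
apply: (@vanishes_sum _ _ w O _ _ predT F _ oO O0) => [k _|k _].
  exact: smooth_onM oO (sb k) (sfk k).
apply: (vanishesM w_gt0 oO O0 (sb k) (sfk k) (p := w k - w j) (q := N - w k)).
- lia.
- apply: order_ge_vanishes; first exact/smooth_frame/smooth_coord.
  by apply: order_ge_frame; exact: x_order.
- exact: vanishes_partial.
Qed.

End OrderInPrivilegedCoordinates.

(** * Composing a chart with a local diffeomorphism *)

Section ChangeOfChart.
Variables (R : realType) (n : nat) (M : topologicalType).
Variables (A : smooth_manifold R n M) (x : pre_chart R n M).
Variables (U : set 'rV[R]_n) (phi psi : 'rV[R]_n -> 'rV[R]_n).
Hypotheses (x_compat : compatible A x) (phi_diffeo : diffeo_on U phi psi).

Local Notation x' := (change_chart x U phi psi).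

Let dom_image z : chart_im x' z -> (phi @` U) z /\ (chart_im x `&` U) (psi z).
Proof.
have [_ _ _ _ phiK] := phi_diffeo.
move=> [p [Cp Up] <-] /=; split; first by exists (chart_map x p).
by rewrite phiK ?inE//; split => //; exists p.
Qed.

Let psi_continuous z : (phi @` U) z -> {for z, continuous psi}.
Proof.
have [_ oU' _ spsi _] := phi_diffeo.
by move=> Uz; exact/differentiable_continuous/(smooth_map_differentiable oU' spsi Uz).
Qed.

Lemma change_chart_is_chart : is_chart x'.
Proof.
have [oU oU' sphi spsi phiK] := phi_diffeo.
have [[oD oI xK xc xi] _] := x_compat.
split => /=.
- exact: open_inP.
(* As a preimage under [psi], which is continuous on the open set phi(U), the image is visibly
   open. *)
- suff -> : chart_im x' = phi @` U `&` psi @^-1` (chart_im x `&` U).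
    apply: open_inP => // [z|]; last exact: openI.
    by rewrite inE; exact: psi_continuous.
  apply/seteqP; split=> [z /dom_image //|z [[u Uu <-]]].
  rewrite /= phiK ?inE// => -[[p Cp pu] _].
  by exists p => /=; [split => //=; rewrite pu|rewrite pu].
- by move=> p; rewrite inE => -[Cp Up] /=; rewrite phiK ?inE// xK ?inE.
- move=> p; rewrite inE => -[Cp Up]; apply: continuous_comp; first by apply: xc; rewrite inE.
  exact/differentiable_continuous/(smooth_map_differentiable oU sphi Up).
- move=> z; rewrite inE => /dom_image [Uz [Iz _]].
  apply: continuous_comp; first exact: psi_continuous.
  by apply: xi; rewrite inE.
Qed.

Lemma change_chart_compatible : compatible A x'.
Proof.
have [oU oU' sphi spsi phiK] := phi_diffeo.
have hx' := change_chart_is_chart.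
have [hx tr] := x_compat; have [oD oI xK xc xi] := hx.
split => // d Ad; have hd := atlas_chart Ad; have [oDd _ dK _ _] := hd.
split=> k.
- have oO := open_chart_image hx' oDd.
  apply: (smooth_on_comp oO (open_chart_image hx oDd) ((tr d Ad).1 k)).
    move=> l; apply: sub_smooth_on (spsi l).
    by move=> _ [p [[Cp Up] _] <-]; exists (chart_map x p).
  by move=> _ [p [[Cp Up] Dp] <-] /=; rewrite phiK ?inE//; exists p.
- have oD' : open (chart_dom x') by case: hx'.
  have oO := open_chart_image hd oD'.
  apply: (smooth_on_comp (G := chart_map x \o chart_inv d) oO oU (sphi k)).
    move=> l; apply: sub_smooth_on ((tr d Ad).2 l).
    by move=> _ [p [Dp [Cp Up]] <-]; exists p.
  by move=> _ [p [Dp [Cp Up]] <-] /=; rewrite dK ?inE.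
Qed.

End ChangeOfChart.

Theorem proposition5p9 (R : realType) (n r : nat) (M : topologicalType)
    (A : smooth_manifold R n M) (H : carnot_manifold A r)
    (w : 'I_n -> nat) (w_seq : is_weight_sequence H w)
    (a : M) (V : set M) (V_open : open V) (Va : V a)
    (X : 'I_n -> vfield R M) (X_frame : H_frame H w V X)
    (x : pre_chart R n M) (x_priv : privileged A w X a x)
    (norm : 'rV[R]_n -> R) (norm_pseudo : pseudo_norm w norm)
    (U : set 'rV[R]_n) (U0 : U 0) (phi psi : 'rV[R]_n -> 'rV[R]_n)
    (phi_diffeo : diffeo_on U phi psi) :
  privileged A w X a (change_chart x U phi psi) <->
  'J phi 0 = 1%:M /\
  exists phihat : 'rV[R]_n -> 'rV[R]_n,
    [/\ polynomial_map phihat, w_homogeneous w phihat, diffeomorphism phihat,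
        'J phihat 0 = 1%:M &
        bigO_w w norm 1 (fun y => phi y - phihat y)].
Proof.
have w_gt0 j : (0 < w j)%N by have [/andP[]] := w_seq j.
have [frame _] := X_frame.
have [[hx x_trans Cxa xa0] x_lin x_ord] := x_priv.
have x_compat : compatible A x by [].
have x_ord_ge k := (x_ord k).1.
have [oU oU' sphi spsi phiK] := phi_diffeo.
have [oD _ xK xc _] := hx.
(* A neighbourhood of a on which the frame, the old coordinates and the new ones are all
   available. *)
pose W := V `&` (chart_dom x `&` chart_map x @^-1` U).
have oW : open W by apply: openI => //; exact: open_inP.
have Wa : W a by split => //; split => //=; rewrite xa0.
have WV : W `<=` V by move=> p [].
have WC : W `<=` chart_dom x by move=> p [_ []].
pose O := chart_map x @` W.
have oO : open O by rewrite /O -[W](setIidr WC); exact: open_chart_image.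
have O0 : O 0 by exists a.
pose y k : M -> R := fun p => phi (chart_map x p) 0 k.
have yE k z : O z -> phi z 0 k = (y k \o chart_inv x) z.
  by move=> [p Wp <-]; rewrite /y /= xK ?inE//; exact: WC.
have yE' k z : O z -> (y k \o chart_inv x) z = phi z 0 k by move=> /yE ->.
have OU : O `<=` U by move=> _ [p [_ [_ Up]] <-].
have sy k : smooth_fun A W (y k).
  apply: (chart_smooth_fun x_compat oW WC).
  exact: (eq_smooth_on oO (yE k) (sub_smooth_on OU (sphi k))).
have y_near k : smooth_near A a (y k) by exists W.
(* Linear adaptedness of the old coordinates identifies the frame derivatives of the new ones at a
   with the Jacobian of [phi]. *)
have dphiE j k : X j a (y k) = partial j (fun z => phi z 0 k) 0.
  rewrite x_lin//; apply: near_eq_derive; apply: near_open oO O0 _ => z.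
  exact: yE'.
have dphi_diff : differentiable phi 0 by exact: smooth_map_differentiable oU sphi U0.
split.
- move=> [[hx' _ Cx'a /= x'a0] x'_lin x'_ord].
  have dphi j k : partial j (fun z => phi z 0 k) 0 = (j == k)%:R.
    rewrite -dphiE x'_lin// -(partial_coordinate_chart j k hx' Cx'a) /=.
    by rewrite x'a0.
  split; first by apply/matrixP => j k; rewrite jacobian_partial// dphi mxE.
  apply: (vanishes_homogeneous_part w_gt0 norm_pseudo oU U0 sphi dphi) => k.
  apply: (eq_vanishes oO O0 (yE' k)).
  exact: (order_ge_vanishes w_gt0 frame x_compat x_lin Cxa xa0 x_ord_ge oW Wa WV WC
    (sy k) (x'_ord k).1).
- move=> [J1 [phihat [_ hom _ _ bO]]].
  have vphi := bigO_w_vanishes w_gt0 norm_pseudo oU U0 sphi hom bO.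
  have phi0 : phi 0 = 0.
    by apply/rowP => k; rewrite (vanishes_at0 (w_gt0 k) (vphi k)) mxE.
  (* This must come from the Jacobian hypothesis: the error term of component k may hide linear
     terms x_j with w_j > w_k. *)
  have dphi j k : partial j (fun z => phi z 0 k) 0 = (j == k)%:R.
    by rewrite -jacobian_partial// J1 mxE.
  have psi0 : psi 0 = 0 by rewrite -{1}phi0 phiK ?inE.
  have U'0 : (phi @` U) 0 by exists 0.
  have dpsi j k : partial j (fun z => psi z 0 k) 0 = (j == k)%:R.
    have U'phi0 : (phi @` U) (phi 0) by exists 0.
    have := partial_comp_tangent_id j oU oU' (spsi k) sphi U0 U'phi0 dphi.
    rewrite phi0 => <-; rewrite -(partial_coordinate j k 0).
    apply/esym/near_eq_derive; apply: near_open oU U0 _ => z Uz /=.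
    by rewrite phiK ?inE.
  have [hx' x'_trans] := change_chart_compatible x_compat phi_diffeo.
  split.
  + split => //; last by rewrite /= xa0.
    by split => //=; rewrite xa0.
  + move=> j f [W' [oW' W'a sf]].
    rewrite x_lin; last by exists W'.
    have oO' := open_chart_image hx oW'.
    have O'0 : (chart_map x @` (chart_dom x `&` W')) (psi 0).
      by rewrite psi0; exists a.
    have sf' := smooth_fun_chart x_compat oW' sf.
    by rewrite [RHS](partial_comp_tangent_id j oU' oO' sf' spsi U'0 O'0 dpsi) psi0.
  + move=> k; split.
      apply: (vanishes_order_ge w_gt0 frame x_compat x_lin Cxa xa0 x_ord_ge oW Wa WV WC (sy k)).
      exact: (eq_vanishes oO O0 (yE k) (vphi k)).
    (* The order is exactly w_k because X_k applied to the k-th new coordinate gives 1 at a. *)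
    exists [:: k]; first by rewrite /word_weight big_seq1.
    by rewrite /= dphiE dphi eqxx oner_eq0.
Qed.
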